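(* Let $\mathbb{T}$ be a time scale, $a,b\in\mathbb{T}$ with $a<b$, let $y_a,y_b,l\in\mathbb{R}$, and let $L(t,u,v)$ and $g(t,u,v)$ be real functions on $[a,b]^\kappa_{\mathbb{T}}\times\mathbb{R}\times\mathbb{R}$, both satisfying the regularity assumption (R) given in the context. Let $$J[y(\cdot)]=\int_a^b L(t,y^\sigma(t),y^\Delta(t))\Delta t,\qquad I[y(\cdot)]=\int_a^b g(t,y^\sigma(t),y^\Delta(t))\Delta t .$$ Suppose that $J$ has a local minimum at $y_\ast\in C^1_{\mathrm{rd}}$ subject to the boundary conditions $y(a)=y_a$, $y(b)=y_b$ and the isoperimetric constraint $I[y(\cdot)]=l$, and that $y_\ast$ is not an extremal for the functional $I$. Then there exists a constant $\lambda\in\mathbb{R}$ such that, with $F=L-\lambda g$, $y_\ast$ satisfies $$F_v^\Delta(t,y^\sigma_\ast(t),y^\Delta_\ast(t))-F_u(t,y^\sigma_\ast(t),y^\Delta_\ast(t))=0\quad\text{for all } t\in[a,b]^{\kappa^2}_{\mathbb{T}}.$$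
   Context: A time scale is a nonempty closed subset of $\mathbb{R}$; $[a,b]_{\mathbb{T}}=[a,b]\cap\mathbb{T}$; $\sigma(t)=\inf\{s\in\mathbb{T}:s>t\}$, $\rho(t)=\sup\{s\in\mathbb{T}:s<t\}$ (with $\inf\emptyset=\sup\mathbb{T}$, $\sup\emptyset=\inf\mathbb{T}$). A superscript $\kappa$ on a time scale (or time scale interval) removes its maximum if that maximum is left-scattered ($\rho(t)<t$); $\kappa^2$ means applying this twice. $f^\sigma=f\circ\sigma$. $f^\Delta$ is the $\Delta$-derivative: $|f(\sigma(t))-f(s)-f^\Delta(t)(\sigma(t)-s)|\le\varepsilon|\sigma(t)-s|$ for $s$ in a neighborhood of $t$ in the time scale, for each $\varepsilon>0$. A function is rd-continuous if continuous at right-dense points ($\sigma(t)=t$) and with finite left-sided limits at left-dense points ($\rho(t)=t$); $C^1_{\mathrm{rd}}$ is the set of $\Delta$-differentiable functions on $[a,b]_{\mathbb{T}}$ with rd-continuous $\Delta$-derivative. $\int_a^b f\Delta t=F(b)-F(a)$ with $F^\Delta=f$. $F_u,F_v$ are partial derivatives in the second and third arguments; $F_v^\Delta(t,y_\ast^\sigma(t),y_\ast^\Delta(t))$ is the $\Delta$-derivative of $t\mapsto F_v(t,y_\ast^\sigma(t),y_\ast^\Delta(t))$. (R) A function $L(t,u,v)$ satisfies (R) if for all $y,\eta\in C^1_{\mathrm{rd}}$, putting $f(t,\varepsilon)=L(t,y^\sigma(t)+\varepsilon\eta^\sigma(t),y^\Delta(t)+\varepsilon\eta^\Delta(t))$,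 the derivatives $f_\varepsilon$ and $f_{\varepsilon\varepsilon}$ are continuous in $\varepsilon$, uniformly in $t$ (for each $\epsilon'>0$ there is $\delta>0$ such that $|\varepsilon_1-\varepsilon_2|<\delta$ implies that the values differ by less than $\epsilon'$ for all $t$). $J$ has a local minimum at $y_\ast$ subject to the constraints if $y_\ast$ satisfies the constraints and there is $\delta>0$ with $J[y_\ast]\le J[y]$ for all $y\in C^1_{\mathrm{rd}}$ satisfying the boundary conditions and the isoperimetric constraint with $\|y-y_\ast\|<\delta$, where $\|f\|=\sup_{t\in[a,b]^\kappa_{\mathbb{T}}}|f^\sigma(t)|+\sup_{t\in[a,b]^\kappa_{\mathbb{T}}}|f^\Delta(t)|$. A function $y_\ast$ satisfying the constraints is an extremal for $I$ if there is a constant $c$ with $g_v(t,y^\sigma_\ast(t),y^\Delta_\ast(t))-\int_a^t g_u(\tau,y^\sigma_\ast(\tau),y^\Delta_\ast(\tau))\Delta\tau=c$ for all $t\in[a,b]^\kappa_{\mathbb{T}}$.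
   Formalization: L and g are assumed jointly differentiable in (u,v) for each t, else the claim fails; J and I are assumed defined on all of C^1_rd; at a left-dense point t with σ(t)=b outside [a,b]^κ, where F_v(σ(t)) is undefined, only continuity of F_v is claimed. *)

(* Defs.v *)
(* Stdlib reals with Coquelicot. A time scale is a predicate X : R -> Prop;
   a function on X is a total function R -> R of which only the values at
   points of X are ever used. *)
From Stdlib Require Export Reals.
From Stdlib Require Import ClassicalEpsilon.
From Coquelicot Require Export Coquelicot.
Open Scope R_scope.

Definition time_scale (X : R -> Prop) : Prop :=
  (exists t, X t) /\ closed X.

(* The Delta-calculus below is applied to this set as a time scale in its own
   right, so that sigma b = b and rho a = a. *)
Definition ts_interval (T : R -> Prop) (a b : R) : R -> Prop :=
  fun t => T t /\ a <= t <= b.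

(* [Glb_Rbar] of the empty set is [p_infty]: the second branch is the
   convention inf (empty) = sup X. Similarly for [rho]. *)
Definition sigma (X : R -> Prop) (t : R) : R :=
  match Glb_Rbar (fun s => X s /\ t < s) with
  | Finite r => r
  | _ => real (Lub_Rbar X)
  end.

Definition rho (X : R -> Prop) (t : R) : R :=
  match Lub_Rbar (fun s => X s /\ s < t) with
  | Finite r => r
  | _ => real (Glb_Rbar X)
  end.

Definition kappa (X : R -> Prop) : R -> Prop :=
  fun t => X t /\ ~ ((forall s, X s -> s <= t) /\ rho X t < t).

Definition is_delta_derive (X : R -> Prop) (f : R -> R) (t l : R) : Prop :=
  forall eps, 0 < eps ->
  exists delta, 0 < delta /\
    forall s, X s -> Rabs (s - t) < delta ->
      Rabs (f (sigma X t) - f s - l * (sigma X t - s))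
        <= eps * Rabs (sigma X t - s).

(* Unique on [kappa X]; unspecified where f is not Delta-differentiable. *)
Definition delta_derive (X : R -> Prop) (f : R -> R) (t : R) : R :=
  epsilon (inhabits 0) (is_delta_derive X f t).

(* Delta-derivative, in the time scale X, of a function f given only on D.
   For t in [kappa (kappa X)] and D = [kappa X] the extension h is immaterial
   whenever sigma X t lies in D. The only other points t are those with
   sigma X t = max X outside [kappa X], where "f (sigma t)" does not refer to
   a value of f; there Delta-differentiability is continuity of f at t. *)
Definition is_delta_derive_on (X D : R -> Prop) (f : R -> R) (t l : R) : Prop :=
  exists h : R -> R, (forall s, D s -> h s = f s) /\ is_delta_derive X h t l.

Definition is_antiderivative (X : R -> Prop) (f F : R -> R) : Prop :=
  forall t, kappa X t -> is_delta_derive X F t (f t).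

Definition delta_integrable (X : R -> Prop) (f : R -> R) : Prop :=
  exists F, is_antiderivative X f F.

(* Meaningful when [delta_integrable X f] and r, s are in X. *)
Definition delta_int (X : R -> Prop) (f : R -> R) (r s : R) : R :=
  epsilon (inhabits 0)
    (fun v => exists F, is_antiderivative X f F /\ v = F s - F r).

(* For f given on D, with right- and left-dense points taken in X. *)
Definition rd_continuous (X D : R -> Prop) (f : R -> R) : Prop :=
  forall t, D t ->
    (sigma X t = t -> filterlim f (within D (locally t)) (locally (f t))) /\
    (rho X t = t ->
       exists l : R,
         filterlim f (within (fun s => D s /\ s < t) (locally t)) (locally l)).

Definition C1rd (X : R -> Prop) (y : R -> R) : Prop :=
  (forall t, kappa X t -> exists l, is_delta_derive X y t l) /\
  rd_continuous X (kappa X) (delta_derive X y).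

Definition sup_kappa (X : R -> Prop) (f : R -> R) : Rbar :=
  Lub_Rbar (fun x => exists t, kappa X t /\ x = Rabs (f t)).

Definition C1rd_norm (X : R -> Prop) (f : R -> R) : Rbar :=
  Rbar_plus (sup_kappa X (fun t => f (sigma X t)))
            (sup_kappa X (delta_derive X f)).

Definition along (X : R -> Prop) (y : R -> R) (L : R -> R -> R -> R) : R -> R :=
  fun t => L t (y (sigma X t)) (delta_derive X y t).

Definition partial_u (L : R -> R -> R -> R) : R -> R -> R -> R :=
  fun t u v => Derive (fun x => L t x v) u.

Definition partial_v (L : R -> R -> R -> R) : R -> R -> R -> R :=
  fun t u v => Derive (fun x => L t u x) v.

Definition unif_continuous_in_eps (D : R -> Prop) (h : R -> R -> R) : Prop :=
  forall e, 0 < e ->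
  exists delta, 0 < delta /\
    forall e1 e2, Rabs (e1 - e2) < delta ->
      forall t, D t -> Rabs (h t e1 - h t e2) < e.

Definition regular (X : R -> Prop) (L : R -> R -> R -> R) : Prop :=
  forall y eta, C1rd X y -> C1rd X eta ->
  let f := fun t e =>
    L t (y (sigma X t) + e * eta (sigma X t))
        (delta_derive X y t + e * delta_derive X eta t) in
  (forall t e, kappa X t ->
     ex_derive (f t) e /\ ex_derive (Derive (f t)) e) /\
  unif_continuous_in_eps (kappa X) (fun t e => Derive (f t) e) /\
  unif_continuous_in_eps (kappa X) (fun t e => Derive (Derive (f t)) e).

(* Standing conventions behind the notation for the functional and for the
   partial derivatives: the integrand is Delta-integrable along every y, and
   L t is differentiable as a function of the pair (u, v), which [regular]
   alone does not imply (it only concerns restrictions to lines). *)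
Definition lagrangian (X : R -> Prop) (L : R -> R -> R -> R) : Prop :=
  (forall t u v, kappa X t -> differentiable_pt (L t) u v) /\
  (forall y, C1rd X y -> delta_integrable X (along X y L)).

Definition functional (X : R -> Prop) (a b : R) (L : R -> R -> R -> R)
    (y : R -> R) : R :=
  delta_int X (along X y L) a b.

Definition admissible (X : R -> Prop) (a b ya yb l : R) (g : R -> R -> R -> R)
    (y : R -> R) : Prop :=
  C1rd X y /\ y a = ya /\ y b = yb /\ functional X a b g y = l.

Definition local_minimum (X : R -> Prop) (a b ya yb l : R)
    (L g : R -> R -> R -> R) (ys : R -> R) : Prop :=
  admissible X a b ya yb l g ys /\
  exists delta, 0 < delta /\
    forall y, admissible X a b ya yb l g y ->
      Rbar_lt (C1rd_norm X (fun t => y t - ys t)) delta ->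
      functional X a b L ys <= functional X a b L y.

Definition extremal (X : R -> Prop) (a : R) (g : R -> R -> R -> R)
    (y : R -> R) : Prop :=
  exists c, forall t, kappa X t ->
    along X y (partial_v g) t - delta_int X (along X y (partial_u g)) a t = c.

(* Main.v *)
Require Import Defs.
From Stdlib Require Import Lra Classical ClassicalEpsilon FunctionalExtensionality.
Open Scope R_scope.

(** Write the first variation of J at y* as the integral of
    L_u eta^sigma + L_v eta^Delta. Taking eta = 1 shows that L_u has a
    Delta-antiderivative P_L, and integration by parts turns the variation into
    the integral of w_L eta^Delta with w_L = L_v - P_L, for every eta vanishing
    at a and b; likewise for I, with w_g. That y* is not an extremal for I means
    that w_g is not constant. The theorem follows once w_L - lambda w_g is a
    constant c for some lambda, for then c + P_L - lambda P_g extends F_v and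
    has the Delta-derivative F_u. So the point is to show that the plane curve
    (w_g, w_L) lies on a line ([collinear]).

    The multiplier rule is usually obtained from the implicit function theorem
    applied to (x1, x2) |-> y* + x1 z1 + x2 z2, but the regularity assumption
    controls the integrands along single lines y + e eta only, and gives no
    uniform differentiability in two parameters. It is enough, however, to use
    pairs z1, z2 whose jets (z^sigma, z^Delta) are both nonzero at one point p
    at most. Off p the integrand sees one direction at a time, and at p it is
    differentiable as a function of (u, v); hence both functionals have a
    gradient at 0 in (x1, x2) ([functional_has_gradient]). Together with
    continuity on lines this is enough for the intermediate value theorem to
    correct the constraint, so at a constrained minimum the two gradients are
    parallel ([constrained_minimum_gradients], [minimum_parallel]).

    Such pairs suffice because of a du Bois-Reymond lemma with a weight phi:
    testing against all phi h of mean zero forces a function to be constant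
    where phi > 0 ([du_bois_reymond]). For p in the time scale, the weights
    (sigma(p) - t)^+ and (sigma(t) - p)^+ lead to test functions whose jets meet
    at p only, and applying the lemma to each of them shows that a chord of the
    curve (w_g, w_L) before sigma(p) is parallel to a chord after it
    ([parallel_chords]). Given t1 < t2 < t3, take p = t2 when t2 is
    right-scattered, since both weights are then positive at t2. When t2 is
    right-dense, take p slightly to the right of t2 and pass to the limit, which
    is possible since a function with an antiderivative cannot jump at t2 away
    from the constant value that it has to the right of t2
    ([right_dense_value]).

    The analysis needed on the time scale rests on one notion: a function G is
    an e-approximate primitive of f if its slopes at t differ from f(t) by at
    most e. The mean value inequality compares such functions; an f that has one
    for every e > 0 has an antiderivative ([antiderivative_of_approx]). This
    gives both the antiderivatives of rd-continuous functions, by gluing line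
    segments, and that of the first variation, by difference quotients. *)

(** * Constrained minima in the plane *)

Definition has_gradient (A : R -> R -> R) (A1 A2 : R) : Prop :=
  forall c, 0 < c -> exists d, 0 < d /\ forall x1 x2,
    Rabs x1 < d -> Rabs x2 < d ->
    Rabs (A x1 x2 - A 0 0 - (x1 * A1 + x2 * A2)) <= c * (Rabs x1 + Rabs x2).

(** If the gradients are independent, there is a direction v along which B
    decreases while A is stationary. On the segment through e v in the direction
    of grad A, of length proportional to e, the value A 0 0 is attained by the
    intermediate value theorem. The segment is so short that B is still smaller
    there than at 0. The constraint set itself need not be a curve, which is why
    continuity of A on lines replaces continuous differentiability. *)
Lemma constrained_minimum_gradients (A B : R -> R -> R) (A1 A2 B1 B2 : R) :
  has_gradient A A1 A2 -> has_gradient B B1 B2 ->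
  (forall p1 p2 q1 q2, continuity (fun s => A (p1 + s * q1) (p2 + s * q2))) ->
  (exists d, 0 < d /\ forall x1 x2, Rabs x1 < d -> Rabs x2 < d ->
     A x1 x2 = A 0 0 -> B 0 0 <= B x1 x2) ->
  A1 * B2 = A2 * B1.
Proof.
  intros HA HB Hcont [d0 [Hd0 Hmin]].
  apply NNPP; intros Hne.
  set (D := Rabs (A1 * B2 - A2 * B1)).
  assert (HD : 0 < D) by (apply Rabs_pos_lt; lra).
  assert (Hv : exists v1 v2, A1 * v1 + A2 * v2 = 0 /\ B1 * v1 + B2 * v2 = - D /\
    Rabs v1 <= Rabs A1 + Rabs A2 /\ Rabs v2 <= Rabs A1 + Rabs A2).
  { pose proof (Rabs_pos A1); pose proof (Rabs_pos A2).
    destruct (Rle_lt_dec 0 (A1 * B2 - A2 * B1)) as [Hs|Hs].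
    - exists A2, (- A1); rewrite Rabs_Ropp; unfold D.
      rewrite Rabs_pos_eq by lra; repeat split; lra.
    - exists (- A2), A1; rewrite Rabs_Ropp; unfold D.
      rewrite Rabs_left by lra; repeat split; lra. }
  destruct Hv as [v1 [v2 [Av [Bv [Hv1 Hv2]]]]].
  set (N := A1 * A1 + A2 * A2).
  assert (HN : 0 < N).
  { unfold N; destruct (Req_dec A1 0) as [E1|E1]; [|nra].
    destruct (Req_dec A2 0) as [E2|E2]; [|nra].
    exfalso; apply Hne; rewrite E1, E2; ring. }
  set (K := Rabs A1 + Rabs A2) in *.
  assert (HK : 0 <= K).
  { unfold K; pose proof (Rabs_pos A1); pose proof (Rabs_pos A2); lra. }
  set (Bn := B1 * A1 + B2 * A2).
  pose proof (Rabs_pos Bn) as HBn.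
  (* along s |-> e v + s grad A with |s| <= r e, the change r e |Bn| of B is at
     most a quarter of the decrease e D due to v *)
  set (r := Rmin 1 (D / (4 * (Rabs Bn + 1)))).
  assert (Hr1 : r <= 1) by apply Rmin_l.
  assert (Hr2 : r <= D / (4 * (Rabs Bn + 1))) by apply Rmin_r.
  assert (Hr : 0 < r).
  { apply Rmin_pos; [lra|apply Rdiv_lt_0_compat; lra]. }
  assert (HrB : r * Rabs Bn <= D / 4).
  { apply Rle_trans with (D / (4 * (Rabs Bn + 1)) * (Rabs Bn + 1)).
    - apply Rmult_le_compat; lra.
    - right; field; lra. }
  set (m := Rmin (r * N) D).
  assert (Hm1 : m <= r * N) by apply Rmin_l.
  assert (Hm2 : m <= D) by apply Rmin_r.
  assert (Hm : 0 < m) by (apply Rmin_pos; [apply Rmult_lt_0_compat|]; lra).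
  set (c := m / (4 * (4 * K + 1))).
  assert (Hc : 0 < c) by (apply Rdiv_lt_0_compat; lra).
  assert (HcK : c * (4 * K) <= m / 4).
  { apply Rle_trans with (c * (4 * K + 1)); [apply Rmult_le_compat_l; lra|].
    right; unfold c; field; lra. }
  destruct (HA c Hc) as [d1 [Hd1 KA]].
  destruct (HB c Hc) as [d2 [Hd2 KB]].
  set (d := Rmin d0 (Rmin d1 d2)).
  assert (Hd : 0 < d) by (repeat apply Rmin_pos; lra).
  assert (Hdd0 : d <= d0) by apply Rmin_l.
  assert (Hdd1 : d <= d1) by (eapply Rle_trans; [apply Rmin_r|apply Rmin_l]).
  assert (Hdd2 : d <= d2) by (eapply Rle_trans; [apply Rmin_r|apply Rmin_r]).
  set (e := d / (2 * K + 1)).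
  assert (He : 0 < e) by (apply Rdiv_lt_0_compat; lra).
  assert (HeK : e * (2 * K) < d).
  { replace d with (e * (2 * K + 1)) by (unfold e; field; lra).
    apply Rmult_lt_compat_l; lra. }
  assert (Hsize : forall s, Rabs s <= r * e ->
    Rabs (e * v1 + s * A1) <= 2 * (e * K) /\ Rabs (e * v2 + s * A2) <= 2 * (e * K)).
  { intros s Hs.
    assert (Hse : Rabs s <= e) by nra.
    assert (HA1 : Rabs A1 <= K) by (unfold K; pose proof (Rabs_pos A2); lra).
    assert (HA2 : Rabs A2 <= K) by (unfold K; pose proof (Rabs_pos A1); lra).
    assert (G : forall x y, Rabs x <= K -> Rabs y <= K ->
      Rabs (e * x + s * y) <= 2 * (e * K)).
    { intros x y Hx Hy.
      eapply Rle_trans; [apply Rabs_triang|]; rewrite !Rabs_mult, (Rabs_pos_eq e) by lra.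
      assert (e * Rabs x <= e * K) by (apply Rmult_le_compat_l; lra).
      assert (Rabs s * Rabs y <= e * K)
        by (apply Rmult_le_compat; auto; apply Rabs_pos).
      lra. }
    split; apply G; auto. }
  assert (HcK' : c * (4 * (e * K)) <= m / 4 * e).
  { replace (c * (4 * (e * K))) with (c * (4 * K) * e) by ring.
    apply Rmult_le_compat_r; lra. }
  assert (HAs : forall s, Rabs s <= r * e ->
    Rabs (A (e * v1 + s * A1) (e * v2 + s * A2) - A 0 0 - s * N) <= m / 4 * e).
  { intros s Hs; destruct (Hsize s Hs) as [S1 S2].
    specialize (KA (e * v1 + s * A1) (e * v2 + s * A2) ltac:(lra) ltac:(lra)).
    replace ((e * v1 + s * A1) * A1 + (e * v2 + s * A2) * A2)
      with (e * (A1 * v1 + A2 * v2) + s * N) in KA by (unfold N; ring).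
    rewrite Av, Rmult_0_r, Rplus_0_l in KA.
    eapply Rle_trans; [exact KA|].
    eapply Rle_trans; [|exact HcK'].
    apply Rmult_le_compat_l; lra. }
  assert (Hre : 0 < r * e) by (apply Rmult_lt_0_compat; lra).
  assert (Hme : m * e <= r * N * e) by (apply Rmult_le_compat_r; lra).
  assert (Hmpos : 0 < m * e) by (apply Rmult_lt_0_compat; lra).
  set (f := fun s => A (e * v1 + s * A1) (e * v2 + s * A2) - A 0 0).
  assert (Hf : continuity f).
  { apply (continuity_minus _ (fun _ => A 0 0)); [apply Hcont|].
    apply continuity_const; intros x y; reflexivity. }
  destruct (IVT_cor f (- (r * e)) (r * e) Hf ltac:(lra)) as [s [Hs Es]].
  { pose proof (HAs (r * e)) as HP; rewrite Rabs_pos_eq in HP by lra.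
    specialize (HP (Rle_refl _)); fold (f (r * e)) in HP.
    pose proof (HAs (- (r * e))) as HM; rewrite Rabs_Ropp, Rabs_pos_eq in HM by lra.
    specialize (HM (Rle_refl _)); fold (f (- (r * e))) in HM.
    apply Rabs_le_between in HP; apply Rabs_le_between in HM.
    assert (0 <= f (r * e)) by lra.
    assert (f (- (r * e)) <= 0) by lra.
    nra. }
  assert (Hs' : Rabs s <= r * e) by (apply Rabs_le; lra).
  destruct (Hsize s Hs') as [S1 S2].
  specialize (Hmin (e * v1 + s * A1) (e * v2 + s * A2) ltac:(lra) ltac:(lra)).
  specialize (Hmin ltac:(unfold f in Es; lra)).
  specialize (KB (e * v1 + s * A1) (e * v2 + s * A2) ltac:(lra) ltac:(lra)).
  replace ((e * v1 + s * A1) * B1 + (e * v2 + s * A2) * B2)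
    with (e * (B1 * v1 + B2 * v2) + s * Bn) in KB by (unfold Bn; ring).
  rewrite Bv in KB.
  assert (HsB : s * Bn <= D / 4 * e).
  { eapply Rle_trans; [apply Rle_abs|]; rewrite Rabs_mult.
    apply Rle_trans with (r * e * Rabs Bn).
    - apply Rmult_le_compat_r; lra.
    - replace (r * e * Rabs Bn) with (r * Rabs Bn * e) by ring.
      apply Rmult_le_compat_r; lra. }
  assert (HcS : c * (Rabs (e * v1 + s * A1) + Rabs (e * v2 + s * A2)) <= D / 4 * e).
  { eapply Rle_trans; [apply Rmult_le_compat_l with (r2 := 4 * (e * K)); lra|].
    eapply Rle_trans; [exact HcK'|].
    apply Rmult_le_compat_r; lra. }
  assert (HDe : 0 < D * e) by (apply Rmult_lt_0_compat; lra).
  apply Rabs_le_between in KB; lra.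
Qed.

(** * Compact time scales *)

Section TimeScale.

Variables (X : R -> Prop) (a b : R).
Hypothesis X_closed : closed X.
Hypothesis X_a : X a.
Hypothesis X_b : X b.
Hypothesis a_lt_b : a < b.
Hypothesis X_bounds : forall t, X t -> a <= t <= b.

Lemma X_adherent x :
  (forall d, 0 < d -> exists s, X s /\ Rabs (s - x) < d) -> X x.
Proof.
  intros H; apply X_closed; intros [d Hd].
  destruct (H d (cond_pos d)) as [s [Xs Hs]].
  exact (Hd s Hs Xs).
Qed.

Lemma Lub_finite E m x :
  E x -> (forall y, E y -> y <= m) ->
  exists r, Lub_Rbar E = Finite r /\ (forall y, E y -> y <= r) /\
    (forall u, (forall y, E y -> y <= u) -> r <= u).
Proof.
  intros Ex Em.
  destruct (Lub_Rbar_correct E) as [Hub Hlub].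
  destruct (Lub_Rbar E) as [r| |].
  - exists r; split; [reflexivity|split].
    + intros y Ey; exact (Hub y Ey).
    + intros u Hu; exact (Hlub u Hu).
  - exfalso; exact (Hlub m Em).
  - exfalso; exact (Hub x Ex).
Qed.

Lemma Glb_finite E m x :
  E x -> (forall y, E y -> m <= y) ->
  exists r, Glb_Rbar E = Finite r /\ (forall y, E y -> r <= y) /\
    (forall u, (forall y, E y -> u <= y) -> u <= r).
Proof.
  intros Ex Em.
  destruct (Glb_Rbar_correct E) as [Hlb Hglb].
  destruct (Glb_Rbar E) as [r| |].
  - exists r; split; [reflexivity|split].
    + intros y Ey; exact (Hlb y Ey).
    + intros u Hu; exact (Hglb u Hu).
  - exfalso; exact (Hlb x Ex).
  - exfalso; exact (Hglb m Em).
Qed.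

Lemma Lub_X : real (Lub_Rbar X) = b.
Proof.
  destruct (Lub_finite X b b X_b) as [r [-> [H1 H2]]].
  { intros y Xy; apply X_bounds, Xy. }
  simpl; apply Rle_antisym; [|apply H1, X_b].
  apply H2; intros y Xy; apply X_bounds, Xy.
Qed.

Lemma Glb_X : real (Glb_Rbar X) = a.
Proof.
  destruct (Glb_finite X a a X_a) as [r [-> [H1 H2]]].
  { intros y Xy; apply X_bounds, Xy. }
  simpl; apply Rle_antisym; [apply H1, X_a|].
  apply H2; intros y Xy; apply X_bounds, Xy.
Qed.

Lemma sigma_b : sigma X b = b.
Proof.
  unfold sigma.
  destruct (Glb_Rbar_correct (fun s => X s /\ b < s)) as [_ Hglb].
  assert (H : is_lb_Rbar (fun s => X s /\ b < s) p_infty).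
  { intros s [Xs Hs]; apply X_bounds in Xs; lra. }
  specialize (Hglb _ H).
  destruct (Glb_Rbar _); simpl in *; try contradiction.
  exact Lub_X.
Qed.

Lemma rho_a : rho X a = a.
Proof.
  unfold rho.
  destruct (Lub_Rbar_correct (fun s => X s /\ s < a)) as [_ Hlub].
  assert (H : is_ub_Rbar (fun s => X s /\ s < a) m_infty).
  { intros s [Xs Hs]; apply X_bounds in Xs; lra. }
  specialize (Hlub _ H).
  destruct (Lub_Rbar _); simpl in *; try contradiction.
  exact Glb_X.
Qed.

Lemma sigma_spec t : t < b ->
  (forall s, X s -> t < s -> sigma X t <= s) /\ t <= sigma X t /\
  (forall d, 0 < d -> exists s, X s /\ t < s < sigma X t + d).
Proof.
  intros Hb; unfold sigma.
  destruct (Glb_finite (fun s => X s /\ t < s) t b) as [r [-> [H1 H2]]].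
  { now split. }
  { intros y [_ Hy]; lra. }
  split; [|split].
  - intros s Xs Hs; apply H1; now split.
  - apply H2; intros y [_ Hy]; lra.
  - intros d Hd.
    apply NNPP; intros Hn.
    assert (r + d <= r); [|lra].
    apply H2; intros y [Xy Hy].
    apply Rnot_lt_le; intros Hlt; apply Hn; exists y; auto.
Qed.

Lemma rho_spec t : a < t ->
  (forall s, X s -> s < t -> s <= rho X t) /\ rho X t <= t /\
  (forall d, 0 < d -> exists s, X s /\ rho X t - d < s < t).
Proof.
  intros Ha; unfold rho.
  destruct (Lub_finite (fun s => X s /\ s < t) t a) as [r [-> [H1 H2]]].
  { now split. }
  { intros y [_ Hy]; lra. }
  split; [|split].
  - intros s Xs Hs; apply H1; now split.
  - apply H2; intros y [_ Hy]; lra.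
  - intros d Hd.
    apply NNPP; intros Hn.
    assert (r <= r - d); [|lra].
    apply H2; intros y [Xy Hy].
    apply Rnot_lt_le; intros Hlt; apply Hn; exists y; auto.
Qed.

Lemma sigma_ge t : X t -> t <= sigma X t.
Proof.
  intros Xt; destruct (X_bounds t Xt) as [_ [Hb| ->]].
  - apply sigma_spec, Hb.
  - rewrite sigma_b; lra.
Qed.

Lemma sigma_le t s : X t -> X s -> t < s -> sigma X t <= s.
Proof.
  intros Xt Xs Hs.
  apply sigma_spec; auto.
  apply X_bounds in Xs; lra.
Qed.

Lemma X_sigma t : X t -> X (sigma X t).
Proof.
  intros Xt; destruct (X_bounds t Xt) as [_ [Hb| ->]].
  - destruct (sigma_spec t Hb) as [H1 [H2 H3]].
    apply X_adherent; intros d Hd.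
    destruct (H3 d Hd) as [s [Xs Hs]]; exists s; split; auto.
    specialize (H1 s Xs (proj1 Hs)).
    rewrite Rabs_pos_eq; lra.
  - now rewrite sigma_b.
Qed.

Lemma right_dense_points t d : X t -> t < b -> sigma X t = t -> 0 < d ->
  exists s, X s /\ t < s < t + d.
Proof.
  intros Xt Hb E Hd; destruct (sigma_spec t Hb) as [_ [_ H]].
  rewrite E in H; exact (H d Hd).
Qed.

Lemma left_dense_points t d : a < t -> rho X t = t -> 0 < d ->
  exists s, X s /\ t - d < s < t.
Proof.
  intros Ha E Hd; destruct (rho_spec t Ha) as [_ [_ H]].
  rewrite E in H; exact (H d Hd).
Qed.

Lemma rho_le t : X t -> rho X t <= t.
Proof.
  intros Xt; destruct (X_bounds t Xt) as [[Ha| <-] _].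
  - apply rho_spec, Ha.
  - rewrite rho_a; lra.
Qed.

Lemma kappa_X t : kappa X t -> X t.
Proof. now intros []. Qed.

Lemma kappa_lt t : X t -> t < b -> kappa X t.
Proof.
  intros Xt Hb; split; auto; intros [H _].
  specialize (H b X_b); lra.
Qed.

Lemma kappa_a : kappa X a.
Proof. now apply kappa_lt. Qed.

Lemma kappa_left_dense t : X t -> rho X t = t -> kappa X t.
Proof. intros Xt E; split; auto; intros [_ H]; lra. Qed.

Lemma kappa_b_dense : kappa X b -> rho X b = b.
Proof.
  intros [_ H]; apply NNPP; intros Hne; apply H; split.
  - intros s Xs; apply X_bounds, Xs.
  - pose proof (rho_le b X_b); lra.
Qed.

Lemma kappa_near t d : kappa X t -> sigma X t = t -> 0 < d ->
  exists s, X s /\ s <> t /\ Rabs (s - t) < d.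
Proof.
  intros Kt E Hd; pose proof (kappa_X t Kt) as Xt.
  destruct (X_bounds t Xt) as [_ [Hb| ->]].
  - destruct (right_dense_points t d Xt Hb E Hd) as [s [Xs Hs]].
    exists s; repeat split; auto; [lra|rewrite Rabs_pos_eq; lra].
  - destruct (left_dense_points b d a_lt_b (kappa_b_dense Kt) Hd)
      as [s [Xs Hs]].
    exists s; repeat split; auto; [lra|rewrite Rabs_left; lra].
Qed.

(** The time-scale form of induction on the reals: the supremum of the points up
    to which P holds belongs to the time scale, and none of the three steps
    allows it to be smaller than a point where P fails. *)
Lemma ts_induction (P : R -> Prop) r :
  X r -> P r ->
  (forall t, X t -> r <= t < b -> t < sigma X t -> P t -> P (sigma X t)) ->
  (forall t, X t -> r <= t < b -> sigma X t = t -> P t ->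
     exists d, 0 < d /\ forall s, X s -> t < s < t + d -> P s) ->
  (forall t, X t -> r < t -> rho X t = t ->
     (forall s, X s -> r <= s < t -> P s) -> P t) ->
  forall t, X t -> r <= t -> P t.
Proof.
  intros Xr Pr Hscat Hdense Hleft t Xt Ht.
  apply NNPP; intros Hn.
  set (E := fun x => X x /\ r <= x /\ forall s, X s -> r <= s <= x -> P s).
  assert (Er : E r).
  { split; [|split]; auto; [lra|]; intros s _ Hs; replace s with r by lra; auto. }
  destruct (Lub_finite E t r Er) as [m [_ [Hub Hlub]]].
  { intros y [Xy [Hy Py]]; apply Rnot_lt_le; intros Hlt.
    apply Hn, Py; auto; lra. }
  assert (Hr : r <= m) by (apply Hub, Er).
  assert (Hmt : m <= t).
  { apply Hlub; intros y [Xy [Hy Py]]; apply Rnot_lt_le; intros Hlt.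
    apply Hn, Py; auto; lra. }
  assert (Happ : forall d, 0 < d -> exists x, E x /\ m - d < x).
  { intros d Hd; apply NNPP; intros Hne.
    assert (m <= m - d); [|lra].
    apply Hlub; intros y Ey; apply Rnot_lt_le; intros Hlt.
    apply Hne; exists y; auto. }
  assert (Xm : X m).
  { apply X_adherent; intros d Hd; destruct (Happ d Hd) as [x [Ex Hx]].
    exists x; split; [apply Ex|].
    specialize (Hub x Ex); rewrite Rabs_left1; lra. }
  assert (Hbelow : forall s, X s -> r <= s < m -> P s).
  { intros s Xs Hs; destruct (Happ (m - s) ltac:(lra)) as [x [Ex Hx]].
    apply Ex; auto; lra. }
  assert (Pm : P m).
  { destruct (Req_dec m r) as [->|Hne]; auto.
    destruct (Req_dec (rho X m) m) as [E1|Hne'].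
    - apply Hleft; auto; lra.
    - assert (Hrm : a < m) by (apply X_bounds in Xr; lra).
      destruct (rho_spec m Hrm) as [H1 [H2 _]].
      destruct (Happ (m - rho X m) ltac:(lra)) as [x [Ex Hx]].
      destruct (Rle_lt_dec m x) as [Hmx|Hmx].
      + apply Ex; auto; lra.
      + specialize (H1 x (proj1 Ex) Hmx); lra. }
  assert (Em : E m).
  { split; [|split]; auto; intros s Xs Hs.
    destruct (Req_dec s m) as [->|]; auto; apply Hbelow; auto; lra. }
  assert (Hmlt : m < t).
  { destruct (Req_dec m t) as [E1|]; [|lra].
    exfalso; apply Hn; rewrite <- E1; exact Pm. }
  assert (Hmb : m < b) by (apply X_bounds in Xt; lra).
  pose proof (sigma_ge m Xm) as Hsm.
  destruct (Req_dec (sigma X m) m) as [E1|Hne].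
  - destruct (Hdense m Xm ltac:(lra) E1 Pm) as [d [Hd HP]].
    destruct (right_dense_points m d Xm Hmb E1 Hd) as [x [Xx Hx]].
    assert (E x); [|specialize (Hub x H); lra].
    split; [|split]; auto; [lra|]; intros s Xs Hs.
    destruct (Rle_lt_dec s m).
    + apply Em; auto; lra.
    + apply HP; auto; lra.
  - assert (E (sigma X m)); [|specialize (Hub _ H); lra].
    split; [|split]; [apply X_sigma, Xm|lra|]; intros s Xs Hs.
    destruct (Rle_lt_dec s m) as [Hle|Hlt].
    + apply Em; auto; lra.
    + pose proof (sigma_le m s Xm Xs Hlt).
      replace s with (sigma X m) by lra.
      apply Hscat; auto; lra.
Qed.

(** * The mean value inequality *)

(** The body of [is_delta_derive] at a fixed tolerance e: a Delta-derivative of G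
    is an l with [near_slope e G t l] for every e > 0. *)
Definition near_slope (e : R) (G : R -> R) (t l : R) : Prop :=
  exists d, 0 < d /\ forall s, X s -> Rabs (s - t) < d ->
    Rabs (G (sigma X t) - G s - l * (sigma X t - s)) <= e * Rabs (sigma X t - s).

Definition ts_cont (G : R -> R) (t : R) : Prop :=
  forall e, 0 < e -> exists d, 0 < d /\
    forall s, X s -> Rabs (s - t) < d -> Rabs (G s - G t) < e.

(** By [ts_induction]. Continuity serves to reach a left-dense t: if t is
    right-scattered, the slope condition compares the values of H at t and on the
    left of t with H(sigma(t)) only, not with each other. *)
Lemma mean_value (H : R -> R) (M r s : R) :
  0 <= M -> X r -> X s -> r <= s ->
  (forall t, kappa X t -> ts_cont H t) ->
  (forall t, kappa X t -> r <= t < s -> near_slope M H t 0) ->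
  Rabs (H s - H r) <= M * (s - r).
Proof.
  intros HM Xr Xs Hrs Hc Hn.
  cut (forall t, X t -> r <= t -> t <= s -> Rabs (H t - H r) <= M * (t - r)).
  { intros HH; apply HH; auto; lra. }
  apply (ts_induction (fun t => t <= s -> Rabs (H t - H r) <= M * (t - r)) r); auto.
  - intros _; rewrite !Rminus_diag, Rabs_R0; lra.
  - intros t Xt Ht Hlt IH Hs.
    destruct (Hn t (kappa_lt t Xt (proj2 Ht)) ltac:(lra)) as [d [Hd HH]].
    specialize (HH t Xt); rewrite Rminus_diag, Rabs_R0 in HH.
    specialize (HH Hd); rewrite (Rabs_pos_eq (sigma X t - t)) in HH by lra.
    specialize (IH ltac:(lra)).
    replace (H (sigma X t) - H r)
      with ((H (sigma X t) - H t - 0 * (sigma X t - t)) + (H t - H r)) by ring.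
    eapply Rle_trans; [apply Rabs_triang|]; lra.
  - intros t Xt Ht E IH.
    destruct (Rle_lt_dec s t) as [Hst|Hst].
    + exists 1; split; [lra|]; intros; lra.
    + destruct (Hn t (kappa_lt t Xt (proj2 Ht)) ltac:(lra)) as [d [Hd HH]].
      exists d; split; auto; intros x Xx Hx Hxs.
      specialize (HH x Xx); rewrite E in HH.
      rewrite (Rabs_pos_eq (x - t)) in HH by lra.
      specialize (HH ltac:(lra)).
      rewrite (Rabs_left (t - x)) in HH by lra.
      specialize (IH ltac:(lra)).
      replace (H x - H r)
        with (- (H t - H x - 0 * (t - x)) + (H t - H r)) by ring.
      eapply Rle_trans; [apply Rabs_triang|]; rewrite Rabs_Ropp; lra.
  - intros t Xt Ht E IH Hs.
    apply Rnot_lt_le; intros Hlt.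
    destruct (Hc t (kappa_left_dense t Xt E) (Rabs (H t - H r) - M * (t - r))
      ltac:(lra)) as [d [Hd HH]].
    assert (Hat : a < t) by (apply X_bounds in Xr; lra).
    destruct (left_dense_points t (Rmin d (t - r)) Hat E) as [x [Xx Hx]].
    { apply Rmin_pos; lra. }
    pose proof (Rmin_l d (t - r)); pose proof (Rmin_r d (t - r)).
    specialize (IH x Xx ltac:(lra) ltac:(lra)).
    specialize (HH x Xx); rewrite Rabs_left in HH by lra.
    specialize (HH ltac:(lra)).
    pose proof (Rabs_triang (H x - H r) (- (H x - H t))) as Ht'.
    rewrite Rabs_Ropp in Ht'.
    replace (H x - H r + - (H x - H t)) with (H t - H r) in Ht' by ring.
    assert (M * (x - r) <= M * (t - r)) by (apply Rmult_le_compat_l; lra).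
    lra.
Qed.

(** * Delta-derivatives *)

Lemma delta_derive_cont f t l : X t -> is_delta_derive X f t l -> ts_cont f t.
Proof.
  intros Xt Hf e He.
  pose proof (sigma_ge t Xt) as Hs.
  set (m := sigma X t - t) in *.
  assert (Hm : 0 <= m) by (unfold m; lra).
  pose proof (Rabs_pos l) as Hl.
  set (e1 := e / (2 * (2 * m + 1))).
  assert (He1 : 0 < e1) by (apply Rdiv_lt_0_compat; lra).
  destruct (Hf e1 He1) as [d [Hd HH]].
  exists (Rmin d (Rmin 1 (e / (2 * (Rabs l + 1))))).
  assert (Hd2 : 0 < e / (2 * (Rabs l + 1))) by (apply Rdiv_lt_0_compat; lra).
  split; [repeat apply Rmin_pos; lra|].
  intros s Xs Hst.
  assert (Hst1 : Rabs (s - t) < d) by (eapply Rlt_le_trans; [exact Hst|apply Rmin_l]).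
  assert (Hst2 : Rabs (s - t) < 1).
  { eapply Rlt_le_trans; [exact Hst|].
    eapply Rle_trans; [apply Rmin_r|apply Rmin_l]. }
  assert (Hst3 : Rabs (s - t) < e / (2 * (Rabs l + 1))).
  { eapply Rlt_le_trans; [exact Hst|].
    eapply Rle_trans; [apply Rmin_r|apply Rmin_r]. }
  pose proof (HH s Xs Hst1) as H1.
  assert (H0 : Rabs (t - t) < d) by (rewrite Rminus_diag, Rabs_R0; lra).
  pose proof (HH t Xt H0) as H2; clear HH H0.
  rewrite (Rabs_pos_eq (sigma X t - t)) in H2 by exact Hm.
  assert (H3 : Rabs (sigma X t - s) <= m + Rabs (s - t)).
  { replace (sigma X t - s) with (m + - (s - t)) by (unfold m; ring).
    eapply Rle_trans; [apply Rabs_triang|].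
    rewrite Rabs_Ropp, (Rabs_pos_eq m Hm); lra. }
  replace (f s - f t) with
    ((f (sigma X t) - f t - l * (sigma X t - t))
     + (- (f (sigma X t) - f s - l * (sigma X t - s)) + l * (s - t))) by ring.
  eapply Rle_lt_trans; [apply Rabs_triang|].
  eapply Rle_lt_trans; [apply Rplus_le_compat_l, Rabs_triang|].
  rewrite Rabs_Ropp, Rabs_mult.
  assert (H4 : e1 * Rabs (sigma X t - s) <= e1 * (m + 1)).
  { apply Rmult_le_compat_l; lra. }
  assert (H5 : Rabs l * Rabs (s - t) <= (Rabs l + 1) * Rabs (s - t)).
  { apply Rmult_le_compat_r; [apply Rabs_pos|lra]. }
  assert (H6 : (Rabs l + 1) * Rabs (s - t) < e / 2).
  { replace (e / 2) with ((Rabs l + 1) * (e / (2 * (Rabs l + 1)))) by (field; lra).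
    apply Rmult_lt_compat_l; lra. }
  assert (H7 : e1 * (m + 1) + e1 * m = e / 2) by (unfold e1; field; lra).
  fold m in H2; fold m; lra.
Qed.

Lemma delta_derive_unique f t l1 l2 : kappa X t ->
  is_delta_derive X f t l1 -> is_delta_derive X f t l2 -> l1 = l2.
Proof.
  intros Kt H1 H2; pose proof (kappa_X t Kt) as Xt.
  apply NNPP; intros Hne.
  assert (He : 0 < Rabs (l1 - l2) / 4).
  { assert (0 < Rabs (l1 - l2)) by (apply Rabs_pos_lt; lra); lra. }
  set (e := Rabs (l1 - l2) / 4) in *.
  destruct (H1 e He) as [d1 [Hd1 HH1]]; destruct (H2 e He) as [d2 [Hd2 HH2]].
  assert (Hs : exists s, X s /\ Rabs (s - t) < Rmin d1 d2 /\ sigma X t - s <> 0).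
  { destruct (Req_dec (sigma X t) t) as [E|E].
    - destruct (kappa_near t (Rmin d1 d2) Kt E) as [s [Xs [Hs1 Hs2]]].
      { apply Rmin_pos; lra. }
      exists s; repeat split; auto; lra.
    - exists t; repeat split; auto; [|lra].
      rewrite Rminus_diag, Rabs_R0; apply Rmin_pos; lra. }
  destruct Hs as [s [Xs [Hs Hne2]]].
  specialize (HH1 s Xs (Rlt_le_trans _ _ _ Hs (Rmin_l _ _))).
  specialize (HH2 s Xs (Rlt_le_trans _ _ _ Hs (Rmin_r _ _))).
  assert (Hp : 0 < Rabs (sigma X t - s)) by (apply Rabs_pos_lt, Hne2).
  assert (Hb : Rabs ((l1 - l2) * (sigma X t - s)) <= 2 * e * Rabs (sigma X t - s)).
  { replace ((l1 - l2) * (sigma X t - s)) with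
      (- (f (sigma X t) - f s - l1 * (sigma X t - s))
       + (f (sigma X t) - f s - l2 * (sigma X t - s))) by ring.
    eapply Rle_trans; [apply Rabs_triang|]; rewrite Rabs_Ropp; lra. }
  rewrite Rabs_mult in Hb; apply Rmult_le_reg_r in Hb; auto.
  unfold e in *; lra.
Qed.

Lemma delta_derive_ext f g t l : X t -> (forall s, X s -> f s = g s) ->
  is_delta_derive X f t l -> is_delta_derive X g t l.
Proof.
  intros Xt E H e He; destruct (H e He) as [d [Hd HH]].
  exists d; split; auto; intros s Xs Hs.
  rewrite <- !E; auto using X_sigma.
Qed.

Lemma delta_derive_linear c m t : is_delta_derive X (fun s => c + m * s) t m.
Proof.
  intros e He; exists 1; split; [lra|]; intros s _ _.
  replace (c + m * sigma X t - (c + m * s) - m * (sigma X t - s)) with 0 by ring.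
  rewrite Rabs_R0; apply Rmult_le_pos; [lra|apply Rabs_pos].
Qed.

Lemma near_slope_plus e1 e2 F G t l m :
  near_slope e1 F t l -> near_slope e2 G t m ->
  near_slope (e1 + e2) (fun s => F s + G s) t (l + m).
Proof.
  intros [d1 [Hd1 H1]] [d2 [Hd2 H2]].
  exists (Rmin d1 d2); split; [apply Rmin_pos; lra|]; intros s Xs Hs.
  specialize (H1 s Xs (Rlt_le_trans _ _ _ Hs (Rmin_l _ _))).
  specialize (H2 s Xs (Rlt_le_trans _ _ _ Hs (Rmin_r _ _))).
  replace (F (sigma X t) + G (sigma X t) - (F s + G s) - (l + m) * (sigma X t - s))
    with ((F (sigma X t) - F s - l * (sigma X t - s))
          + (G (sigma X t) - G s - m * (sigma X t - s))) by ring.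
  eapply Rle_trans; [apply Rabs_triang|]; lra.
Qed.

Lemma near_slope_scal e c F t l :
  near_slope e F t l -> near_slope (Rabs c * e) (fun s => c * F s) t (c * l).
Proof.
  intros [d [Hd H]]; exists d; split; auto; intros s Xs Hs.
  specialize (H s Xs Hs).
  replace (c * F (sigma X t) - c * F s - c * l * (sigma X t - s))
    with (c * (F (sigma X t) - F s - l * (sigma X t - s))) by ring.
  rewrite Rabs_mult, Rmult_assoc.
  apply Rmult_le_compat_l; [apply Rabs_pos|exact H].
Qed.

Lemma near_slope_weaken e e' F t l l' :
  near_slope e F t l -> e + Rabs (l' - l) <= e' -> near_slope e' F t l'.
Proof.
  intros [d [Hd H]] He; exists d; split; auto; intros s Xs Hs.
  specialize (H s Xs Hs).
  replace (F (sigma X t) - F s - l' * (sigma X t - s))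
    with ((F (sigma X t) - F s - l * (sigma X t - s))
          + - ((l' - l) * (sigma X t - s))) by ring.
  eapply Rle_trans; [apply Rabs_triang|].
  rewrite Rabs_Ropp, Rabs_mult.
  apply Rle_trans with ((e + Rabs (l' - l)) * Rabs (sigma X t - s)); [lra|].
  apply Rmult_le_compat_r; [apply Rabs_pos|exact He].
Qed.

Lemma delta_derive_plus f g t l m :
  is_delta_derive X f t l -> is_delta_derive X g t m ->
  is_delta_derive X (fun s => f s + g s) t (l + m).
Proof.
  intros Hf Hg e He; replace e with (e / 2 + e / 2) by field.
  change (near_slope (e / 2 + e / 2) (fun s => f s + g s) t (l + m)).
  apply near_slope_plus; [apply Hf|apply Hg]; lra.
Qed.

Lemma delta_derive_scal c f t l :
  is_delta_derive X f t l -> is_delta_derive X (fun s => c * f s) t (c * l).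
Proof.
  intros Hf e He.
  assert (Hc : 0 < Rabs c + 1) by (pose proof (Rabs_pos c); lra).
  change (near_slope e (fun s => c * f s) t (c * l)).
  apply near_slope_weaken with (Rabs c * (e / (Rabs c + 1))) (c * l).
  - apply near_slope_scal, Hf, Rdiv_lt_0_compat; lra.
  - rewrite Rminus_diag, Rabs_R0.
    replace e with ((Rabs c + 1) * (e / (Rabs c + 1))) at 2 by (field; lra).
    assert (0 < e / (Rabs c + 1)) by (apply Rdiv_lt_0_compat; lra).
    lra.
Qed.

Lemma delta_derive_minus f g t l m :
  is_delta_derive X f t l -> is_delta_derive X g t m ->
  is_delta_derive X (fun s => f s - g s) t (l - m).
Proof.
  intros Hf Hg.
  apply (delta_derive_scal (-1)) in Hg.
  pose proof (delta_derive_plus _ _ _ _ _ Hf Hg) as H.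
  replace (l + -1 * m) with (l - m) in H by ring.
  intros e He; destruct (H e He) as [d [Hd HH]]; exists d; split; auto.
  intros s Xs Hs; specialize (HH s Xs Hs); cbv beta in HH |- *.
  replace (f (sigma X t) - g (sigma X t) - (f s - g s))
    with (f (sigma X t) + -1 * g (sigma X t) - (f s + -1 * g s)) by ring.
  exact HH.
Qed.

Lemma delta_derive_mult f g t l m : X t ->
  is_delta_derive X f t l -> is_delta_derive X g t m ->
  is_delta_derive X (fun s => f s * g s) t (l * g (sigma X t) + f t * m).
Proof.
  intros Xt Hf Hg e He.
  pose proof (delta_derive_cont f t l Xt Hf) as Hc.
  set (A := Rabs (g (sigma X t)) + 1); set (B := Rabs (f t) + 1).
  set (C := Rabs m + 1).
  assert (HA : 0 < A) by (unfold A; pose proof (Rabs_pos (g (sigma X t))); lra).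
  assert (HB : 0 < B) by (unfold B; pose proof (Rabs_pos (f t)); lra).
  assert (HC : 0 < C) by (unfold C; pose proof (Rabs_pos m); lra).
  assert (eA : 0 < e / 3 / A) by (apply Rdiv_lt_0_compat; lra).
  assert (eB : 0 < e / 3 / B) by (apply Rdiv_lt_0_compat; lra).
  assert (eC : 0 < Rmin 1 (e / 3 / C)).
  { apply Rmin_pos; [lra|apply Rdiv_lt_0_compat; lra]. }
  destruct (Hf _ eA) as [d1 [Hd1 H1]].
  destruct (Hg _ eB) as [d2 [Hd2 H2]].
  destruct (Hc _ eC) as [d3 [Hd3 H3]].
  exists (Rmin d1 (Rmin d2 d3)).
  split; [repeat apply Rmin_pos; lra|]; intros s Xs Hs.
  specialize (H1 s Xs (Rlt_le_trans _ _ _ Hs (Rmin_l _ _))).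
  specialize (H2 s Xs (Rlt_le_trans _ _ _ Hs
    (Rle_trans _ _ _ (Rmin_r _ _) (Rmin_l _ _)))).
  specialize (H3 s Xs (Rlt_le_trans _ _ _ Hs
    (Rle_trans _ _ _ (Rmin_r _ _) (Rmin_r _ _)))).
  pose proof (Rmin_l 1 (e / 3 / C)); pose proof (Rmin_r 1 (e / 3 / C)).
  set (S := sigma X t) in *.
  set (D := Rabs (S - s)) in *.
  assert (HD : 0 <= D) by apply Rabs_pos.
  replace (f S * g S - f s * g s - (l * g S + f t * m) * (S - s))
    with (g S * (f S - f s - l * (S - s)) + (f s * (g S - g s - m * (S - s))
          + (f s - f t) * m * (S - s))) by ring.
  eapply Rle_trans; [apply Rabs_triang|].
  eapply Rle_trans; [apply Rplus_le_compat_l, Rabs_triang|].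
  rewrite !Rabs_mult; fold D.
  assert (K1 : Rabs (g S) * Rabs (f S - f s - l * (S - s)) <= A * (e / 3 / A * D)).
  { apply Rmult_le_compat; try apply Rabs_pos; [unfold A; lra|exact H1]. }
  assert (K2 : Rabs (f s) * Rabs (g S - g s - m * (S - s)) <= B * (e / 3 / B * D)).
  { apply Rmult_le_compat; try apply Rabs_pos; [|exact H2].
    replace (f s) with (f t + (f s - f t)) by ring.
    eapply Rle_trans; [apply Rabs_triang|]; unfold B; lra. }
  assert (K3 : Rabs (f s - f t) * Rabs m * D <= e / 3 / C * C * D).
  { apply Rmult_le_compat_r; auto.
    apply Rmult_le_compat; try apply Rabs_pos; [lra|unfold C; lra]. }
  replace (A * (e / 3 / A * D)) with (e / 3 * D) in K1 by (field; lra).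
  replace (B * (e / 3 / B * D)) with (e / 3 * D) in K2 by (field; lra).
  replace (e / 3 / C * C * D) with (e / 3 * D) in K3 by (field; lra).
  lra.
Qed.

(** * Antiderivatives *)

Definition approx_primitive_at (f : R -> R) (e : R) (G : R -> R) (t : R) : Prop :=
  near_slope e G t (f t) /\ ts_cont G t.

(** Continuity is a separate requirement because, for a fixed e, it does not
    follow from the slopes. *)
Definition approx_primitive (f : R -> R) (e : R) (G : R -> R) : Prop :=
  forall t, kappa X t -> approx_primitive_at f e G t.

Lemma antiderivative_approx f F e :
  is_antiderivative X f F -> 0 < e -> approx_primitive f e F.
Proof.
  intros HF He t Kt; split.
  - exact (HF t Kt e He).
  - apply delta_derive_cont with (f t); auto using kappa_X.
Qed.

Lemma ts_cont_minus F G t :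
  ts_cont F t -> ts_cont G t -> ts_cont (fun s => F s - G s) t.
Proof.
  intros HF HG e He.
  destruct (HF (e / 2) ltac:(lra)) as [d1 [Hd1 H1]].
  destruct (HG (e / 2) ltac:(lra)) as [d2 [Hd2 H2]].
  exists (Rmin d1 d2); split; [apply Rmin_pos; lra|]; intros s Xs Hs.
  specialize (H1 s Xs (Rlt_le_trans _ _ _ Hs (Rmin_l _ _))).
  specialize (H2 s Xs (Rlt_le_trans _ _ _ Hs (Rmin_r _ _))).
  replace (F s - G s - (F t - G t)) with ((F s - F t) + - (G s - G t)) by ring.
  eapply Rle_lt_trans; [apply Rabs_triang|]; rewrite Rabs_Ropp; lra.
Qed.

Lemma approx_primitive_diff f g e1 e2 c F G r s :
  approx_primitive f e1 F -> approx_primitive g e2 G ->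
  0 <= e1 + e2 + c -> X r -> X s -> r <= s ->
  (forall t, kappa X t -> r <= t < s -> Rabs (f t - g t) <= c) ->
  Rabs ((F s - F r) - (G s - G r)) <= (e1 + e2 + c) * (s - r).
Proof.
  intros HF HG He Xr Xs Hrs Hc.
  replace (F s - F r - (G s - G r)) with ((F s - G s) - (F r - G r)) by ring.
  apply (mean_value (fun x => F x - G x)); auto.
  - intros t Kt; apply ts_cont_minus; [apply HF|apply HG]; auto.
  - intros t Kt Ht.
    destruct (HF t Kt) as [[d1 [Hd1 H1]] _].
    destruct (HG t Kt) as [[d2 [Hd2 H2]] _].
    exists (Rmin d1 d2); split; [apply Rmin_pos; lra|]; intros x Xx Hx.
    specialize (H1 x Xx (Rlt_le_trans _ _ _ Hx (Rmin_l _ _))).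
    specialize (H2 x Xx (Rlt_le_trans _ _ _ Hx (Rmin_r _ _))).
    set (S := sigma X t) in *.
    replace (F S - G S - (F x - G x) - 0 * (S - x)) with
      ((F S - F x - f t * (S - x)) + (- (G S - G x - g t * (S - x))
        + (f t - g t) * (S - x))) by ring.
    eapply Rle_trans; [apply Rabs_triang|].
    eapply Rle_trans; [apply Rplus_le_compat_l, Rabs_triang|].
    rewrite Rabs_Ropp, Rabs_mult.
    assert (Rabs (f t - g t) * Rabs (S - x) <= c * Rabs (S - x)).
    { apply Rmult_le_compat_r; [apply Rabs_pos|auto]. }
    lra.
Qed.

Lemma antiderivative_diff f g F G c r s :
  is_antiderivative X f F -> is_antiderivative X g G ->
  0 <= c -> X r -> X s -> r <= s ->
  (forall t, kappa X t -> r <= t < s -> Rabs (f t - g t) <= c) ->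
  Rabs ((F s - F r) - (G s - G r)) <= c * (s - r).
Proof.
  intros HF HG Hc Xr Xs Hrs H.
  apply Rnot_lt_le; intros Hlt.
  set (D := Rabs (F s - F r - (G s - G r)) - c * (s - r)).
  assert (HD : 0 < D) by (unfold D; lra).
  set (e := D / (4 * (s - r + 1))).
  assert (He : 0 < e) by (apply Rdiv_lt_0_compat; lra).
  pose proof (approx_primitive_diff f g e e c F G r s
    (antiderivative_approx _ _ _ HF He) (antiderivative_approx _ _ _ HG He)
    ltac:(lra) Xr Xs Hrs H) as HH.
  assert (E : e * (s - r + 1) = D / 4) by (unfold e; field; lra).
  unfold D in *; nra.
Qed.

Lemma antiderivative_unique f g F G r s :
  is_antiderivative X f F -> is_antiderivative X g G ->
  X r -> X s -> r <= s ->
  (forall t, kappa X t -> r <= t < s -> f t = g t) ->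
  F s - F r = G s - G r.
Proof.
  intros HF HG Xr Xs Hrs H.
  pose proof (antiderivative_diff f g F G 0 r s HF HG (Rle_refl 0) Xr Xs Hrs) as HH.
  rewrite Rmult_0_l in HH.
  apply Rminus_diag_uniq, Rabs_eq_0, Rle_antisym; [|apply Rabs_pos].
  apply HH; intros t Kt Ht; rewrite H, Rminus_diag, Rabs_R0 by auto; lra.
Qed.

Lemma antiderivative_ext f g F :
  is_antiderivative X f F -> (forall t, kappa X t -> f t = g t) ->
  is_antiderivative X g F.
Proof. intros HF E t Kt; rewrite <- E; auto. Qed.

Lemma delta_int_eq f F r s :
  is_antiderivative X f F -> X r -> X s -> r <= s -> delta_int X f r s = F s - F r.
Proof.
  intros HF Xr Xs Hrs; unfold delta_int.
  destruct (epsilon_spec (inhabits 0)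
    (fun v => exists G, is_antiderivative X f G /\ v = G s - G r)) as [G [HG ->]].
  - exists (F s - F r), F; auto.
  - apply (antiderivative_unique f f); auto.
Qed.

(** By the mean value inequality the approximate primitives for e = 1/(n+1),
    normalized at a, form a Cauchy sequence, and the increments of the n-th one
    differ from those of the limit by at most 2/(n+1) times the distance. *)
Lemma antiderivative_of_approx f :
  (forall e, 0 < e -> exists G, approx_primitive f e G) ->
  exists F, is_antiderivative X f F.
Proof.
  intros H.
  set (en := fun n => / INR (S n)).
  assert (Hen : forall n, 0 < en n).
  { intros n; apply Rinv_0_lt_compat, lt_0_INR; auto with arith. }
  set (G := fun n => proj1_sig
    (constructive_indefinite_description _ (H (en n) (Hen n)))).
  assert (HG : forall n, approx_primitive f (en n) (G n)).
  { intros n; unfold G; destruct (constructive_indefinite_description _ _); auto. }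
  set (F := fun s => real (Lim_seq (fun n => G n s - G n a))).
  assert (Hsmall : forall e, 0 < e -> exists N, forall n, (N <= n)%nat -> en n < e).
  { intros e He; destruct (archimed_cor1 e He) as [N [HN HN0]].
    exists N; intros n Hn; eapply Rle_lt_trans; [|exact HN].
    apply Rinv_le_contravar; [apply lt_0_INR, HN0|].
    apply le_INR; auto with arith. }
  assert (Hd : forall n m r s, X r -> X s ->
    Rabs ((G n s - G n r) - (G m s - G m r)) <= (en n + en m) * Rabs (s - r)).
  { intros n m.
    assert (Hle : forall r s, X r -> X s -> r <= s ->
      Rabs ((G n s - G n r) - (G m s - G m r)) <= (en n + en m) * (s - r)).
    { intros r s Xr Xs Hrs; replace (en n + en m) with (en n + en m + 0) by ring.
      pose proof (Hen n); pose proof (Hen m).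
      apply approx_primitive_diff with f f; auto; [lra|].
      intros; rewrite Rminus_diag, Rabs_R0; lra. }
    intros r s Xr Xs; destruct (Rle_lt_dec r s).
    - rewrite (Rabs_pos_eq (s - r)) by lra; auto.
    - rewrite (Rabs_left (s - r)), <- Rabs_Ropp by lra.
      replace (- (G n s - G n r - (G m s - G m r)))
        with (G n r - G n s - (G m r - G m s)) by ring.
      replace (- (s - r)) with (r - s) by ring; apply Hle; auto; lra. }
  assert (Hlim : forall s, X s -> is_lim_seq (fun n => G n s - G n a) (F s)).
  { intros s Xs; apply Lim_seq_correct', ex_lim_seq_cauchy_corr.
    intros [e He]; simpl.
    pose proof (X_bounds s Xs).
    destruct (Hsmall (e / (2 * (s - a + 1)))) as [N HN].
    { apply Rdiv_lt_0_compat; lra. }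
    exists N; intros n m Hn Hm.
    eapply Rle_lt_trans; [apply Hd; auto|].
    rewrite Rabs_pos_eq by lra.
    pose proof (HN n Hn); pose proof (HN m Hm).
    pose proof (Hen n); pose proof (Hen m).
    apply Rle_lt_trans with ((en n + en m) * (s - a + 1)).
    { apply Rmult_le_compat_l; lra. }
    replace e with ((e / (2 * (s - a + 1)) + e / (2 * (s - a + 1))) * (s - a + 1))
      by (field; lra).
    apply Rmult_lt_compat_r; lra. }
  assert (HF : forall n r s, X r -> X s ->
    Rabs ((G n s - G n r) - (F s - F r)) <= 2 * en n * Rabs (s - r)).
  { intros n r s Xr Xs.
    set (u := fun m => Rabs ((G n s - G n r)
      - ((G m s - G m a) - (G m r - G m a)))).
    assert (Hu : is_lim_seq u (Rabs ((G n s - G n r) - (F s - F r)))).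
    { apply (is_lim_seq_abs _ (Finite (G n s - G n r - (F s - F r)))).
      apply is_lim_seq_minus'; [apply is_lim_seq_const|].
      apply is_lim_seq_minus'; auto. }
    apply (is_lim_seq_le_loc u (fun _ => 2 * en n * Rabs (s - r))
      (Finite (Rabs ((G n s - G n r) - (F s - F r))))
      (Finite (2 * en n * Rabs (s - r)))); auto; [|apply is_lim_seq_const].
    exists n; intros m Hm; unfold u.
    replace (G m s - G m a - (G m r - G m a)) with (G m s - G m r) by ring.
    eapply Rle_trans; [apply Hd; auto|].
    apply Rmult_le_compat_r; [apply Rabs_pos|].
    assert (en m <= en n); [|lra].
    apply Rinv_le_contravar; [apply lt_0_INR; auto with arith|].
    apply le_INR; auto with arith. }
  exists F; intros t Kt e He.
  pose proof (kappa_X t Kt) as Xt.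
  destruct (Hsmall (e / 3) ltac:(lra)) as [n Hn]; specialize (Hn n (le_n n)).
  destruct (HG n t Kt) as [[d [Hd0 HH]] _].
  exists d; split; auto; intros s Xs Hs; specialize (HH s Xs Hs).
  specialize (HF n s (sigma X t) Xs (X_sigma t Xt)).
  set (S := sigma X t) in *.
  replace (F S - F s - f t * (S - s)) with
    (- (G n S - G n s - (F S - F s)) + (G n S - G n s - f t * (S - s))) by ring.
  eapply Rle_trans; [apply Rabs_triang|]; rewrite Rabs_Ropp.
  assert (3 * en n * Rabs (S - s) <= e * Rabs (S - s)); [|lra].
  apply Rmult_le_compat_r; [apply Rabs_pos|lra].
Qed.

(** * rd-continuous functions *)

Lemma filterlim_within_iff (D : R -> Prop) f t l :
  filterlim f (within D (locally t)) (locally l) <->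
  forall e, 0 < e -> exists d, 0 < d /\
    forall s, D s -> Rabs (s - t) < d -> Rabs (f s - l) < e.
Proof.
  split.
  - intros H e He.
    destruct (H (fun y => Rabs (y - l) < e)) as [d Hd].
    { exists (mkposreal e He); intros y Hy; exact Hy. }
    exists d; split; [apply cond_pos|]; intros s Ds Hs; exact (Hd s Hs Ds).
  - intros H P [e He].
    destruct (H e (cond_pos e)) as [d [Hd HH]].
    exists (mkposreal d Hd); intros s Hs Ds.
    apply He, HH; [exact Ds|exact Hs].
Qed.

Definition rd_cont : (R -> R) -> Prop := rd_continuous X (kappa X).

Lemma rd_cont_comp2 (op : R -> R -> R) f g :
  (forall x y, filterlim (fun z => op (fst z) (snd z))
     (filter_prod (locally x) (locally y)) (locally (op x y))) ->
  rd_cont f -> rd_cont g -> rd_cont (fun t => op (f t) (g t)).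
Proof.
  intros Hop Hf Hg t Kt.
  destruct (Hf t Kt) as [Hf1 Hf2], (Hg t Kt) as [Hg1 Hg2]; split; intros E.
  - eapply filterlim_comp_2; [exact (Hf1 E)|exact (Hg1 E)|apply Hop].
  - destruct (Hf2 E) as [l Hl], (Hg2 E) as [m Hm]; exists (op l m).
    eapply filterlim_comp_2; [exact Hl|exact Hm|apply Hop].
Qed.

Lemma rd_cont_plus f g : rd_cont f -> rd_cont g -> rd_cont (fun t => f t + g t).
Proof.
  apply rd_cont_comp2; intros x y; apply (filterlim_plus (V := R_NormedModule)).
Qed.

Lemma rd_cont_mult f g : rd_cont f -> rd_cont g -> rd_cont (fun t => f t * g t).
Proof.
  apply rd_cont_comp2; intros x y; apply (filterlim_mult (K := R_AbsRing)).
Qed.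

Lemma rd_cont_continuous f :
  (forall t, kappa X t -> ts_cont f t) -> rd_cont f.
Proof.
  intros H t Kt; split; [intros _|intros _; exists (f t)];
    apply filterlim_within_iff; intros e He; destruct (H t Kt e He) as [d [Hd HH]]; exists d; split; auto;
    intros s Ds; apply HH.
  - apply kappa_X, Ds.
  - apply kappa_X, Ds.
Qed.

Lemma rd_cont_const c : rd_cont (fun _ => c).
Proof.
  apply rd_cont_continuous; intros t _ e He; exists 1; split; [lra|].
  intros; rewrite Rminus_diag, Rabs_R0; exact He.
Qed.

(** At a right-dense t a point x of the time scale just to the right of t bounds
    sigma on [t, x), so sigma is continuous there; from the left, sigma maps
    (t - d, t) into (t - d, t]. *)
Lemma rd_cont_comp_sigma k :
  (forall t, kappa X t -> ts_cont k t) -> rd_cont (fun t => k (sigma X t)).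
Proof.
  intros H t Kt; pose proof (kappa_X t Kt) as Xt.
  assert (Hleft : forall d s, kappa X s -> s < t -> Rabs (s - t) < d ->
            Rabs (sigma X s - t) < d).
  { intros d s Ks Hst Hd; pose proof (kappa_X s Ks) as Xs.
    pose proof (sigma_ge s Xs); pose proof (sigma_le s t Xs Xt Hst).
    rewrite Rabs_left in Hd by lra; rewrite Rabs_left1; lra. }
  split; [intros E|intros _; exists (k t)]; apply filterlim_within_iff;
    intros e He; destruct (H t Kt e He) as [d [Hd HH]].
  - rewrite E.
    assert (Hx : exists d', 0 < d' /\ d' <= d /\
      forall s, X s -> t <= s < t + d' -> sigma X s < t + d).
    { destruct (X_bounds t Xt) as [_ [Hb| ->]].
      - destruct (right_dense_points t d Xt Hb E Hd) as [x [Xx Hx]].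
        exists (x - t); repeat split; [lra|lra|]; intros s Xs Hs.
        pose proof (sigma_le s x Xs Xx ltac:(lra)); lra.
      - exists d; repeat split; [lra|lra|]; intros s Xs Hs.
        replace s with b by (apply X_bounds in Xs; lra).
        rewrite sigma_b; lra. }
    destruct Hx as [d' [Hd' [Hdd Hx]]].
    exists d'; split; auto; intros s Ks Hs; pose proof (kappa_X s Ks) as Xs.
    apply HH; [apply X_sigma, Xs|].
    destruct (Rle_lt_dec t s) as [Hts|Hst].
    + rewrite Rabs_pos_eq in Hs by lra.
      pose proof (sigma_ge s Xs); specialize (Hx s Xs ltac:(lra)).
      rewrite Rabs_pos_eq; lra.
    + apply Hleft; auto; lra.
  - exists d; split; auto; intros s [Ks Hst] Hs.
    apply HH; [apply X_sigma, kappa_X, Ks|auto].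
Qed.

Lemma rd_cont_right f t : rd_cont f -> kappa X t -> sigma X t = t ->
  forall e, 0 < e -> exists d, 0 < d /\
    forall s, kappa X s -> Rabs (s - t) < d -> Rabs (f s - f t) < e.
Proof. intros Hf Kt E; apply filterlim_within_iff, (Hf t Kt), E. Qed.

Lemma rd_cont_left f t : rd_cont f -> X t -> rho X t = t ->
  exists l, forall e, 0 < e -> exists d, 0 < d /\
    forall s, kappa X s -> s < t -> Rabs (s - t) < d -> Rabs (f s - l) < e.
Proof.
  intros Hf Xt E.
  destruct (Hf t (kappa_left_dense t Xt E)) as [_ H]; destruct (H E) as [l Hl].
  exists l; intros e He.
  destruct (proj1 (filterlim_within_iff _ _ _ _) Hl e He) as [d [Hd HH]].
  exists d; split; auto.
Qed.

Lemma rd_cont_bounded f : rd_cont f ->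
  exists M, forall t, kappa X t -> Rabs (f t) <= M.
Proof.
  intros Hf.
  assert (H : exists M, forall s, kappa X s -> s < b -> Rabs (f s) <= M).
  2: { destruct H as [M HM]; exists (Rmax M (Rabs (f b))); intros s Ks.
       destruct (X_bounds s (kappa_X s Ks)) as [_ [Hb| ->]].
       - eapply Rle_trans; [apply HM; auto|apply Rmax_l].
       - apply Rmax_r. }
  apply (ts_induction
    (fun t => exists M, forall s, kappa X s -> s < t -> Rabs (f s) <= M) a);
    auto; [| | | |lra].
  - exists 0; intros s Ks Hs; apply kappa_X, X_bounds in Ks; lra.
  - intros t Xt Ht Hlt [M HM]; exists (Rmax M (Rabs (f t))); intros s Ks Hs.
    destruct (Rtotal_order s t) as [Hst|[->|Hst]].
    + eapply Rle_trans; [apply HM; auto|apply Rmax_l].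
    + apply Rmax_r.
    + pose proof (sigma_le t s Xt (kappa_X s Ks) Hst); lra.
  - intros t Xt Ht E [M HM].
    destruct (rd_cont_right f t Hf (kappa_lt t Xt (proj2 Ht)) E 1 ltac:(lra))
      as [d [Hd HH]].
    exists d; split; auto; intros x Xx Hx.
    exists (Rmax M (Rabs (f t) + 1)); intros s Ks Hs.
    destruct (Rle_lt_dec t s) as [Hts|Hst].
    + eapply Rle_trans; [|apply Rmax_r].
      specialize (HH s Ks); rewrite (Rabs_pos_eq (s - t)) in HH by lra.
      specialize (HH ltac:(lra)).
      replace (f s) with ((f s - f t) + f t) by ring.
      eapply Rle_trans; [apply Rabs_triang|]; lra.
    + eapply Rle_trans; [apply HM; auto|apply Rmax_l].
  - intros t Xt Ht E IH.
    destruct (rd_cont_left f t Hf Xt E) as [l Hl].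
    destruct (Hl 1 ltac:(lra)) as [d [Hd HH]].
    destruct (left_dense_points t d Ht E Hd) as [x [Xx Hx]].
    destruct (IH x Xx) as [M HM]; [apply X_bounds in Xx; lra|].
    exists (Rmax M (Rabs l + 1)); intros s Ks Hs.
    destruct (Rle_lt_dec x s) as [Hxs|Hsx].
    + eapply Rle_trans; [|apply Rmax_r].
      specialize (HH s Ks Hs); rewrite Rabs_left in HH by lra.
      specialize (HH ltac:(lra)).
      replace (f s) with ((f s - l) + l) by ring.
      eapply Rle_trans; [apply Rabs_triang|]; lra.
    + eapply Rle_trans; [apply HM; auto|apply Rmax_l].
Qed.

(** What an approximate primitive built on [a, x] has to satisfy at x in order to
    be continued by a line; a slope is required only if x is right-dense, for
    otherwise the slope at x involves values beyond x. *)
Definition approx_primitive_left (f : R -> R) (e : R) (G : R -> R) (x : R) : Prop :=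
  (forall c, 0 < c -> exists d, 0 < d /\
     forall s, X s -> x - d < s <= x -> Rabs (G s - G x) < c) /\
  (kappa X x -> sigma X x = x -> exists d, 0 < d /\
     forall s, X s -> x - d < s <= x ->
       Rabs (G x - G s - f x * (x - s)) <= e * (x - s)).

Definition extend_line (G : R -> R) (x l : R) : R -> R :=
  fun s => if Rle_dec s x then G s else G x + l * (s - x).

Lemma extend_line_left G x l s : s <= x -> extend_line G x l s = G s.
Proof. intros H; unfold extend_line; destruct (Rle_dec s x); [auto|lra]. Qed.

Lemma extend_line_right G x l s :
  x <= s -> extend_line G x l s = G x + l * (s - x).
Proof.
  intros H; unfold extend_line; destruct (Rle_dec s x); [|auto].
  replace s with x by lra; ring.
Qed.

Lemma extend_line_approx_before f e G x l t :
  X x -> kappa X t -> t < x -> approx_primitive_at f e G t -> approx_primitive_at f e (extend_line G x l) t.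
Proof.
  intros Xx Kt Htx [[d1 [Hd1 H1]] Hc]; pose proof (kappa_X t Kt) as Xt.
  split.
  - exists (Rmin d1 (x - t)); split; [apply Rmin_pos; lra|]; intros s Xs Hs.
    specialize (H1 s Xs (Rlt_le_trans _ _ _ Hs (Rmin_l _ _))).
    pose proof (Rlt_le_trans _ _ _ Hs (Rmin_r _ _)) as H2.
    pose proof (Rle_abs (s - t)); pose proof (sigma_le t x Xt Xx Htx).
    rewrite !extend_line_left by lra; exact H1.
  - intros c Hc0; destruct (Hc c Hc0) as [d2 [Hd2 H2]].
    exists (Rmin d2 (x - t)); split; [apply Rmin_pos; lra|]; intros s Xs Hs.
    specialize (H2 s Xs (Rlt_le_trans _ _ _ Hs (Rmin_l _ _))).
    pose proof (Rlt_le_trans _ _ _ Hs (Rmin_r _ _)) as H3.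
    pose proof (Rle_abs (s - t)).
    rewrite !extend_line_left by lra; exact H2.
Qed.

Lemma extend_line_approx_after f e G x l t :
  kappa X t -> x < t -> Rabs (f t - l) <= e -> approx_primitive_at f e (extend_line G x l) t.
Proof.
  intros Kt Hxt He; pose proof (kappa_X t Kt) as Xt.
  pose proof (sigma_ge t Xt) as Hs0.
  split.
  - exists (t - x); split; [lra|]; intros s Xs Hs.
    pose proof (Rabs_def2 _ _ Hs).
    rewrite !extend_line_right by lra.
    replace (G x + l * (sigma X t - x) - (G x + l * (s - x)) - f t * (sigma X t - s))
      with (- (f t - l) * (sigma X t - s)) by ring.
    rewrite Rabs_mult, Rabs_Ropp.
    apply Rmult_le_compat_r; [apply Rabs_pos|exact He].
  - intros c Hc.
    assert (Hl : 0 < Rabs l + 1) by (pose proof (Rabs_pos l); lra).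
    assert (Hq : 0 < c / (Rabs l + 1)) by (apply Rdiv_lt_0_compat; lra).
    exists (Rmin (t - x) (c / (Rabs l + 1))).
    split; [apply Rmin_pos; lra|]; intros s Xs Hs.
    pose proof (Rlt_le_trans _ _ _ Hs (Rmin_l _ _)) as H1.
    pose proof (Rlt_le_trans _ _ _ Hs (Rmin_r _ _)) as H2.
    pose proof (Rabs_def2 _ _ H1).
    rewrite !extend_line_right by lra.
    replace (G x + l * (s - x) - (G x + l * (t - x))) with (l * (s - t)) by ring.
    rewrite Rabs_mult.
    apply Rle_lt_trans with ((Rabs l + 1) * Rabs (s - t)).
    { apply Rmult_le_compat_r; [apply Rabs_pos|lra]. }
    replace c with ((Rabs l + 1) * (c / (Rabs l + 1))) by (field; lra).
    apply Rmult_lt_compat_l; lra.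
Qed.

(** At a right-scattered x the slope across the gap is l, and points on the left
    of x contribute only the small variation of G; the inequality on l is strict
    to leave room for it. *)
Lemma extend_line_approx_at f e G x l :
  kappa X x -> approx_primitive_left f e G x -> Rabs (f x - l) < e ->
  approx_primitive_at f e (extend_line G x l) x.
Proof.
  intros Kx [Hc Hsl] He; pose proof (kappa_X x Kx) as Xx; pose proof (sigma_ge x Xx) as Hs0.
  assert (Hcont : ts_cont (extend_line G x l) x).
  { intros c Hc0; destruct (Hc c Hc0) as [d [Hd H1]].
    assert (Hl : 0 < Rabs l + 1) by (pose proof (Rabs_pos l); lra).
    assert (Hq : 0 < c / (Rabs l + 1)) by (apply Rdiv_lt_0_compat; lra).
    exists (Rmin d (c / (Rabs l + 1))).
    split; [apply Rmin_pos; lra|]; intros s Xs Hs.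
    pose proof (Rlt_le_trans _ _ _ Hs (Rmin_l _ _)) as H2.
    pose proof (Rlt_le_trans _ _ _ Hs (Rmin_r _ _)) as H3.
    pose proof (Rabs_def2 _ _ H2).
    rewrite (extend_line_left G x l x) by lra.
    destruct (Rle_lt_dec s x) as [Hsx|Hxs].
    - rewrite extend_line_left by lra; apply H1; auto; lra.
    - rewrite extend_line_right by lra.
      replace (G x + l * (s - x) - G x) with (l * (s - x)) by ring.
      rewrite Rabs_mult.
      apply Rle_lt_trans with ((Rabs l + 1) * Rabs (s - x)).
      { apply Rmult_le_compat_r; [apply Rabs_pos|lra]. }
      replace c with ((Rabs l + 1) * (c / (Rabs l + 1))) by (field; lra).
      apply Rmult_lt_compat_l; lra. }
  split; auto.
  destruct (Req_dec (sigma X x) x) as [E|Hne].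
  - destruct (Hsl Kx E) as [d [Hd H1]]; exists d; split; auto; intros s Xs Hs.
    pose proof (Rabs_def2 _ _ Hs); rewrite E.
    rewrite (extend_line_left G x l x) by lra.
    destruct (Rle_lt_dec s x) as [Hsx|Hxs].
    + rewrite extend_line_left, (Rabs_pos_eq (x - s)) by lra; apply H1; auto; lra.
    + rewrite extend_line_right by lra.
      replace (G x - (G x + l * (s - x)) - f x * (x - s))
        with (- (f x - l) * (x - s)) by ring.
      rewrite Rabs_mult, Rabs_Ropp.
      apply Rmult_le_compat_r; [apply Rabs_pos|lra].
  - set (m := sigma X x - x) in *.
    assert (Hm : 0 < m) by (unfold m; lra).
    (* the strict inequality |f x - l| < e leaves room for the variation of G *)
    set (k := (e - Rabs (f x - l)) * m / 2).
    assert (Hk : 0 < k) by (unfold k; apply Rdiv_lt_0_compat; nra).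
    destruct (Hc k Hk) as [d [Hd H1]].
    assert (Hf : 0 < Rabs (f x) + 1) by (pose proof (Rabs_pos (f x)); lra).
    assert (Hq : 0 < k / (Rabs (f x) + 1)) by (apply Rdiv_lt_0_compat; lra).
    exists (Rmin m (Rmin d (k / (Rabs (f x) + 1)))).
    split; [repeat apply Rmin_pos; lra|]; intros s Xs Hs.
    pose proof (Rlt_le_trans _ _ _ Hs (Rmin_l _ _)) as Hs1.
    pose proof (Rlt_le_trans _ _ _ Hs (Rle_trans _ _ _ (Rmin_r _ _) (Rmin_l _ _)))
      as Hs2.
    pose proof (Rlt_le_trans _ _ _ Hs (Rle_trans _ _ _ (Rmin_r _ _) (Rmin_r _ _)))
      as Hs3.
    pose proof (Rabs_def2 _ _ Hs1); pose proof (Rabs_def2 _ _ Hs2).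
    assert (Hsx : s <= x).
    { apply Rnot_lt_le; intros Hlt; pose proof (sigma_le x s Xx Xs Hlt).
      unfold m in *; lra. }
    rewrite extend_line_right, extend_line_left by lra; fold m.
    specialize (H1 s Xs ltac:(lra)).
    replace (sigma X x - s) with (m + (x - s)) by (unfold m; ring).
    rewrite (Rabs_pos_eq (m + (x - s))) by lra.
    replace (G x + l * m - G s - f x * (m + (x - s))) with
      (- (G s - G x) + (- (f x - l) * m + f x * (s - x))) by ring.
    eapply Rle_trans; [apply Rabs_triang|].
    eapply Rle_trans; [apply Rplus_le_compat_l, Rabs_triang|].
    rewrite !Rabs_mult, !Rabs_Ropp, (Rabs_pos_eq m) by lra.
    assert (Rabs (f x) * Rabs (s - x) <= k).
    { apply Rle_trans with ((Rabs (f x) + 1) * (k / (Rabs (f x) + 1))).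
      - apply Rmult_le_compat; try apply Rabs_pos; lra.
      - right; field; lra. }
    assert (2 * k = (e - Rabs (f x - l)) * m) by (unfold k; field).
    assert (0 <= e * (x - s)).
    { apply Rmult_le_pos; [|lra]; pose proof (Rabs_pos (f x - l)); lra. }
    lra.
Qed.

Lemma extend_line_approx_left f e G x l t :
  X t -> x < t -> (kappa X t -> sigma X t = t -> Rabs (f t - l) <= e) ->
  approx_primitive_left f e (extend_line G x l) t.
Proof.
  intros Xt Hxt He; split.
  - intros c Hc.
    assert (Hl : 0 < Rabs l + 1) by (pose proof (Rabs_pos l); lra).
    assert (Hq : 0 < c / (Rabs l + 1)) by (apply Rdiv_lt_0_compat; lra).
    exists (Rmin (t - x) (c / (Rabs l + 1))).
    split; [apply Rmin_pos; lra|]; intros s Xs Hs.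
    pose proof (Rmin_l (t - x) (c / (Rabs l + 1))).
    pose proof (Rmin_r (t - x) (c / (Rabs l + 1))).
    rewrite !extend_line_right by lra.
    replace (G x + l * (s - x) - (G x + l * (t - x))) with (l * (s - t)) by ring.
    rewrite Rabs_mult, (Rabs_left1 (s - t)) by lra.
    apply Rle_lt_trans with ((Rabs l + 1) * - (s - t)).
    { apply Rmult_le_compat_r; lra. }
    replace c with ((Rabs l + 1) * (c / (Rabs l + 1))) by (field; lra).
    apply Rmult_lt_compat_l; lra.
  - intros Kt E; exists (t - x); split; [lra|]; intros s Xs Hs.
    rewrite !extend_line_right by lra.
    replace (G x + l * (t - x) - (G x + l * (s - x)) - f t * (t - s))
      with (- (f t - l) * (t - s)) by ring.
    rewrite Rabs_mult, Rabs_Ropp, (Rabs_pos_eq (t - s)) by lra.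
    apply Rmult_le_compat_r; [lra|auto].
Qed.

(** By [ts_induction] on the right end of the interval of construction. The
    primitive is continued with slope f(t) across a gap or to the right of a
    right-dense t, and, to reach a left-dense t, with slope the left limit at t,
    starting from a point so close that f is near this limit from there on. *)
Lemma rd_cont_approx f e : rd_cont f -> 0 < e ->
  exists G, approx_primitive f e G.
Proof.
  intros Hf He.
  assert (Hxx : forall x, Rabs (x - x) < e).
  { intros x; rewrite Rminus_diag, Rabs_R0; exact He. }
  assert (Hglue : forall x l G, X x ->
    (forall t, kappa X t -> t < x -> approx_primitive_at f e G t) -> approx_primitive_left f e G x ->
    Rabs (f x - l) < e ->
    forall t, kappa X t -> (x < t -> Rabs (f t - l) <= e) ->
      approx_primitive_at f e (extend_line G x l) t).
  { intros x l G Xx HG HL Hl t Kt Ht.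
    destruct (Rtotal_order t x) as [Htx|[->|Htx]].
    - apply extend_line_approx_before; auto.
    - apply extend_line_approx_at; auto.
    - apply extend_line_approx_after; auto. }
  assert (Hb : exists G, (forall t, kappa X t -> t < b -> approx_primitive_at f e G t) /\
                 approx_primitive_left f e G b).
  2: { destruct Hb as [G [HG HL]]; exists (extend_line G b (f b)).
       intros t Kt; apply Hglue; auto.
       intros Hlt; apply kappa_X, X_bounds in Kt; lra. }
  apply (ts_induction (fun x => exists G,
    (forall t, kappa X t -> t < x -> approx_primitive_at f e G t) /\ approx_primitive_left f e G x) a);
    auto; [| | | |lra].
  - exists (fun _ => 0); split.
    + intros t Kt Ht; apply kappa_X, X_bounds in Kt; lra.
    + split.
      * intros c Hc; exists 1; split; [lra|]; intros.
        rewrite Rminus_diag, Rabs_R0; lra.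
      * intros _ _; exists 1; split; [lra|]; intros s Xs Hs.
        replace s with a by (apply X_bounds in Xs; lra).
        rewrite !Rminus_diag, Rmult_0_r, Rminus_diag, Rabs_R0; lra.
  - intros t Xt Ht Hlt [G [HG HL]]; exists (extend_line G t (f t)).
    split.
    + intros s Ks Hs; apply Hglue; auto.
      intros Hts; pose proof (sigma_le t s Xt (kappa_X s Ks) Hts); lra.
    + split.
      * intros c Hc; exists (sigma X t - t); split; [lra|]; intros s Xs Hs.
        pose proof (sigma_le t s Xt Xs ltac:(lra)).
        replace s with (sigma X t) by lra.
        rewrite Rminus_diag, Rabs_R0; exact Hc.
      * intros _ _; exists (sigma X t - t); split; [lra|]; intros s Xs Hs.
        pose proof (sigma_le t s Xt Xs ltac:(lra)).
        replace s with (sigma X t) by lra.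
        rewrite !Rminus_diag, !Rmult_0_r, Rminus_diag, Rabs_R0; lra.
  - intros t Xt Ht E [G [HG HL]].
    destruct (rd_cont_right f t Hf (kappa_lt t Xt (proj2 Ht)) E e He)
      as [d [Hd HH]].
    exists d; split; auto; intros x Xx Hxt; exists (extend_line G t (f t)).
    assert (Hn : forall s, kappa X s -> t < s < t + d -> Rabs (f s - f t) <= e).
    { intros s Ks Hs; left; apply HH; auto; rewrite Rabs_pos_eq; lra. }
    split.
    + intros s Ks Hs; apply Hglue; auto; intros Hts; apply Hn; auto; lra.
    + apply extend_line_approx_left; [exact Xx|lra|].
      intros Kx _; apply Hn; auto; lra.
  - intros t Xt Ht E IH.
    destruct (rd_cont_left f t Hf Xt E) as [l Hl].
    destruct (Hl (e / 2) ltac:(lra)) as [d [Hd HH]].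
    assert (Hn : forall s, kappa X s -> t - d < s < t -> Rabs (f s - l) < e / 2).
    { intros s Ks Hs; apply HH; auto; [lra|]; rewrite Rabs_left; lra. }
    destruct (left_dense_points t d Ht E Hd) as [x [Xx Hx]].
    destruct (IH x Xx) as [G [HG HL]]; [apply X_bounds in Xx; lra|].
    assert (Kx : kappa X x) by (apply kappa_lt; auto; apply X_bounds in Xt; lra).
    exists (extend_line G x l); split.
    + intros s Ks Hs; apply Hglue; auto.
      * specialize (Hn x Kx Hx); lra.
      * intros Hxs; specialize (Hn s Ks ltac:(lra)); lra.
    + apply extend_line_approx_left; [exact Xt|lra|].
      intros Kt E'.
      (* at a two-sided dense point the left limit is the value *)
      destruct (rd_cont_right f t Hf Kt E' (e / 2) ltac:(lra)) as [d' [Hd' HH']].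
      destruct (left_dense_points t (Rmin d d') Ht E) as [y [Xy Hy]].
      { apply Rmin_pos; lra. }
      pose proof (Rmin_l d d'); pose proof (Rmin_r d d').
      assert (Ky : kappa X y) by (apply kappa_lt; auto; apply X_bounds in Xt; lra).
      specialize (Hn y Ky ltac:(lra)).
      specialize (HH' y Ky); rewrite Rabs_left in HH' by lra.
      specialize (HH' ltac:(lra)).
      replace (f t - l) with (- (f y - f t) + (f y - l)) by ring.
      eapply Rle_trans; [apply Rabs_triang|]; rewrite Rabs_Ropp; lra.
Qed.

Lemma rd_cont_antiderivative f :
  rd_cont f -> exists F, is_antiderivative X f F.
Proof.
  intros Hf; apply antiderivative_of_approx; intros e He.
  apply rd_cont_approx; auto.
Qed.

(** * The weighted du Bois-Reymond lemma *)

(** A relation, since most integrands below are known only to have some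
    antiderivative, and identities between integrals are then obtained by linear
    combination of the antiderivatives. *)
Definition has_int (f : R -> R) (v : R) : Prop :=
  exists F, is_antiderivative X f F /\ v = F b - F a.

Lemma has_int_unique f v w : has_int f v -> has_int f w -> v = w.
Proof.
  intros [F [HF ->]] [G [HG ->]].
  apply (antiderivative_unique f f); auto; lra.
Qed.

Lemma has_int_ext f g v :
  (forall t, kappa X t -> f t = g t) -> has_int f v -> has_int g v.
Proof.
  intros E [F [HF ->]]; exists F; split; auto.
  eapply antiderivative_ext; eauto.
Qed.

Lemma has_int_plus f g v w :
  has_int f v -> has_int g w -> has_int (fun t => f t + g t) (v + w).
Proof.
  intros [F [HF ->]] [G [HG ->]]; exists (fun t => F t + G t); split; [|ring].
  intros t Kt; apply delta_derive_plus; auto.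
Qed.

Lemma has_int_scal c f v : has_int f v -> has_int (fun t => c * f t) (c * v).
Proof.
  intros [F [HF ->]]; exists (fun t => c * F t); split; [|ring].
  intros t Kt; apply delta_derive_scal; auto.
Qed.

Lemma rd_cont_has_int f : rd_cont f -> exists v, has_int f v.
Proof.
  intros Hf; destruct (rd_cont_antiderivative f Hf) as [F HF].
  exists (F b - F a), F; auto.
Qed.

(** Derived from the two-sided comparison [antiderivative_diff], which is why f
    is assumed rd-continuous: it provides an upper bound for f. *)
Lemma antiderivative_nonneg f F r s :
  rd_cont f -> (forall t, kappa X t -> 0 <= f t) -> is_antiderivative X f F ->
  X r -> X s -> r <= s -> F r <= F s.
Proof.
  intros Hf H0 HF Xr Xs Hrs.
  destruct (rd_cont_bounded f Hf) as [M HM].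
  assert (HM0 : 0 <= M).
  { eapply Rle_trans; [apply Rabs_pos|apply (HM a kappa_a)]. }
  (* 0 <= f <= M says that f is within M/2 of the constant M/2 *)
  pose proof (antiderivative_diff f (fun _ => M / 2) F (fun x => 0 + M / 2 * x)
    (M / 2) r s HF (fun t _ => delta_derive_linear 0 (M / 2) t)
    ltac:(lra) Xr Xs Hrs) as H.
  assert (H' : forall t, kappa X t -> r <= t < s -> Rabs (f t - M / 2) <= M / 2).
  { intros t Kt _; specialize (H0 t Kt); specialize (HM t Kt).
    rewrite Rabs_pos_eq in HM by lra; apply Rabs_le; split; lra. }
  specialize (H H').
  apply Rabs_le_between in H; lra.
Qed.

Lemma nonneg_int_zero f F :
  rd_cont f -> (forall t, kappa X t -> 0 <= f t) -> is_antiderivative X f F ->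
  F b <= F a -> forall t, kappa X t -> f t = 0.
Proof.
  intros Hf H0 HF Hba t Kt; pose proof (kappa_X t Kt) as Xt.
  apply (delta_derive_unique F t); auto.
  apply delta_derive_ext with (fun s => F a + 0 * s); auto using delta_derive_linear.
  intros s Xs; rewrite Rmult_0_l, Rplus_0_r.
  pose proof (antiderivative_nonneg f F a s Hf H0 HF X_a Xs
    (proj1 (X_bounds s Xs))).
  pose proof (antiderivative_nonneg f F s b Hf H0 HF Xs X_b
    (proj2 (X_bounds s Xs))).
  lra.
Qed.

(** The only integrability available for L_v - P: nothing says that this function
    is rd-continuous. *)
Definition rd_multipliable (w : R -> R) : Prop :=
  forall h, rd_cont h -> exists v, has_int (fun t => w t * h t) v.

(** Let c be the mean of w with respect to phi, V the primitive of phi (w - c)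
    vanishing at a, hence at b, and k a primitive of V. Testing with
    h = k^sigma - m, where m makes the mean of phi h zero, and integrating
    V^Delta k^sigma by parts, one finds that the integral of V^2 is zero. So V = 0
    and phi (w - c) = V^Delta = 0. The proof only integrates products of w with
    rd-continuous functions. *)
Lemma du_bois_reymond w phi :
  rd_multipliable w -> rd_cont phi -> (forall t, kappa X t -> 0 <= phi t) ->
  (forall h, rd_cont h -> has_int (fun t => phi t * h t) 0 ->
     has_int (fun t => w t * (phi t * h t)) 0) ->
  forall s r, kappa X s -> kappa X r -> 0 < phi s -> 0 < phi r -> w s = w r.
Proof.
  intros Hw Hphi Hpos Horth.
  destruct (rd_cont_antiderivative phi Hphi) as [Ph HPh].
  destruct (Hw phi Hphi) as [v [W [HW Ev]]].
  set (I := Ph b - Ph a).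
  destruct (Rle_lt_dec I 0) as [HI|HI].
  { intros s r Ks _ Hs _.
    rewrite (nonneg_int_zero phi Ph Hphi Hpos HPh) in Hs; auto; [lra|].
    unfold I in HI; lra. }
  set (c := v / I).
  set (V := fun t => (W t - c * Ph t) + - (W a - c * Ph a)).
  assert (HV : is_antiderivative X (fun t => w t * phi t - c * phi t) V).
  { intros t Kt; unfold V.
    replace (w t * phi t - c * phi t) with (w t * phi t - c * phi t + 0) by ring.
    apply (delta_derive_plus (fun t => W t - c * Ph t)
      (fun _ => - (W a - c * Ph a))).
    - apply delta_derive_minus; [apply HW, Kt|].
      apply delta_derive_scal, HPh, Kt.
    - apply delta_derive_ext with (fun s => - (W a - c * Ph a) + 0 * s);
        auto using kappa_X, delta_derive_linear.
      intros; ring. }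
  assert (Va : V a = 0) by (unfold V; ring).
  assert (Vb : V b = 0).
  { replace (V b) with (v - c * I) by (unfold V, I; rewrite Ev; ring).
    unfold c; field; lra. }
  assert (HVrd : rd_cont V).
  { apply rd_cont_continuous; intros t Kt.
    apply (delta_derive_cont V t _ (kappa_X t Kt) (HV t Kt)). }
  destruct (rd_cont_antiderivative V HVrd) as [k Hk].
  assert (Hks : rd_cont (fun t => k (sigma X t))).
  { apply rd_cont_comp_sigma; intros t Kt.
    apply (delta_derive_cont k t _ (kappa_X t Kt) (Hk t Kt)). }
  destruct (rd_cont_has_int _ (rd_cont_mult _ _ Hphi Hks)) as [u Hu].
  set (m := u / I).
  set (h := fun t => k (sigma X t) + - m).
  assert (Hh : rd_cont h) by (apply rd_cont_plus; auto using rd_cont_const).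
  assert (Hh0 : has_int (fun t => phi t * h t) 0).
  { assert (HI0 : has_int phi I) by (exists Ph; auto).
    pose proof (has_int_plus _ _ _ _ Hu (has_int_scal (- m) _ _ HI0)) as H.
    replace (u + - m * I) with 0 in H by (unfold m; field; lra).
    revert H; apply has_int_ext; intros t _; unfold h; ring. }
  destruct Hh0 as [H [HH EH]].
  destruct (Horth h Hh (ex_intro _ H (conj HH EH))) as [G [HG EG]].
  (* V^2 = V k^Delta, so Q is the integration by parts of V^Delta k^sigma, with
     the mean m of k^sigma subtracted *)
  set (Q := fun t => V t * k t - ((G t - c * H t) + m * V t)).
  assert (HQ : is_antiderivative X (fun t => V t * V t) Q).
  { intros t Kt; unfold Q.
    replace (V t * V t) with
      ((w t * phi t - c * phi t) * k (sigma X t) + V t * V t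
       - ((w t * (phi t * h t) - c * (phi t * h t))
          + m * (w t * phi t - c * phi t))) by (unfold h; ring).
    apply (delta_derive_minus (fun t => V t * k t)
      (fun t => (G t - c * H t) + m * V t)).
    - apply delta_derive_mult; auto using kappa_X.
    - apply (delta_derive_plus (fun t => G t - c * H t) (fun t => m * V t)).
      + apply delta_derive_minus; [apply HG, Kt|].
        apply delta_derive_scal, HH, Kt.
      + apply delta_derive_scal, HV, Kt. }
  assert (HVV : forall t, kappa X t -> V t * V t = 0).
  { apply (nonneg_int_zero _ Q); auto using rd_cont_mult.
    - intros t _; apply Rle_0_sqr.
    - unfold Q; rewrite Va, Vb.
      replace (G b) with (G a) by lra; replace (H b) with (H a) by lra; lra. }
  assert (HV0 : forall t, X t -> V t = 0).
  { intros t Xt; destruct (X_bounds t Xt) as [_ [Htb| ->]]; auto.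
    apply Rsqr_0_uniq, HVV, kappa_lt; auto. }
  assert (Hfin : forall t, kappa X t -> 0 < phi t -> w t = c).
  { intros t Kt Ht; pose proof (kappa_X t Kt) as Xt.
    assert (E : w t * phi t - c * phi t = 0).
    { apply (delta_derive_unique V t); auto.
      apply delta_derive_ext with (fun s => 0 + 0 * s);
        auto using delta_derive_linear.
      intros s Xs; rewrite HV0 by auto; ring. }
    apply (Rmult_eq_reg_r (phi t)); lra. }
  intros s r Ks Kr Hs Hr; rewrite !Hfin; auto.
Qed.

(** * rd-continuously Delta-differentiable functions *)

Lemma delta_derive_eq f t l :
  kappa X t -> is_delta_derive X f t l -> delta_derive X f t = l.
Proof.
  intros Kt H; apply (delta_derive_unique f t); auto.
  unfold delta_derive; apply epsilon_spec; exists l; exact H.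
Qed.

Lemma C1rd_antiderivative y : C1rd X y -> is_antiderivative X (delta_derive X y) y.
Proof.
  intros [H _] t Kt; unfold delta_derive; apply epsilon_spec, H, Kt.
Qed.

Lemma rd_cont_ext f g :
  (forall t, kappa X t -> f t = g t) -> rd_cont f -> rd_cont g.
Proof.
  intros E Hf t Kt; destruct (Hf t Kt) as [H1 H2]; split; intros Hd.
  - apply filterlim_within_iff; intros e He.
    destruct (proj1 (filterlim_within_iff _ _ _ _) (H1 Hd) e He) as [d [Hd0 HH]].
    exists d; split; auto; intros s Ks; rewrite <- !E by auto; auto.
  - destruct (H2 Hd) as [l Hl]; exists l.
    apply filterlim_within_iff; intros e He.
    destruct (proj1 (filterlim_within_iff _ _ _ _) Hl e He) as [d [Hd0 HH]].
    exists d; split; auto; intros s [Ks Hs]; rewrite <- E by auto; auto.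
Qed.

Lemma C1rd_of_antiderivative h F :
  rd_cont h -> is_antiderivative X h F -> C1rd X F.
Proof.
  intros Hh HF; split.
  - intros t Kt; exists (h t); auto.
  - apply (rd_cont_ext h); auto.
    intros t Kt; symmetry; apply delta_derive_eq; auto.
Qed.

Lemma C1rd_lin y z e : C1rd X y -> C1rd X z ->
  is_antiderivative X (fun t => delta_derive X y t + e * delta_derive X z t)
    (fun t => y t + e * z t) /\
  C1rd X (fun t => y t + e * z t).
Proof.
  intros Hy Hz.
  assert (HA : is_antiderivative X
    (fun t => delta_derive X y t + e * delta_derive X z t)
    (fun t => y t + e * z t)).
  { intros t Kt; apply (delta_derive_plus y (fun t => e * z t)).
    - apply C1rd_antiderivative; auto.
    - apply delta_derive_scal, C1rd_antiderivative; auto. }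
  split; auto.
  apply C1rd_of_antiderivative with (2 := HA).
  apply rd_cont_plus; [apply Hy|].
  apply rd_cont_mult; [apply rd_cont_const|apply Hz].
Qed.

Lemma C1rd_linear c m : C1rd X (fun t => c + m * t).
Proof.
  apply C1rd_of_antiderivative with (fun _ => m).
  - apply rd_cont_const.
  - intros t _; apply delta_derive_linear.
Qed.

(** * First variation of a functional *)

Definition variation (L : R -> R -> R -> R) (y eta : R -> R) (t : R) : R :=
  along X y (partial_u L) t * eta (sigma X t)
  + along X y (partial_v L) t * delta_derive X eta t.

Definition along_line (L : R -> R -> R -> R) (y eta : R -> R) (t e : R) : R :=
  L t (y (sigma X t) + e * eta (sigma X t))
      (delta_derive X y t + e * delta_derive X eta t).

Lemma along_line_eq L y eta t e : C1rd X y -> C1rd X eta -> kappa X t ->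
  along X (fun s => y s + e * eta s) L t = along_line L y eta t e.
Proof.
  intros Hy Heta Kt; unfold along, along_line.
  destruct (C1rd_lin y eta e Hy Heta) as [HA _].
  rewrite (delta_derive_eq _ _ _ Kt (HA t Kt)); reflexivity.
Qed.

Definition comb (z1 z2 : R -> R) (x1 x2 : R) : R -> R :=
  fun s => x1 * z1 s + x2 * z2 s.

Lemma C1rd_comb z1 z2 x1 x2 : C1rd X z1 -> C1rd X z2 ->
  is_antiderivative X
    (fun t => x1 * delta_derive X z1 t + x2 * delta_derive X z2 t)
    (comb z1 z2 x1 x2) /\
  C1rd X (comb z1 z2 x1 x2).
Proof.
  intros H1 H2.
  assert (HA : is_antiderivative X
    (fun t => x1 * delta_derive X z1 t + x2 * delta_derive X z2 t)
    (comb z1 z2 x1 x2)).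
  { intros t Kt; apply (delta_derive_plus (fun s => x1 * z1 s) (fun s => x2 * z2 s));
      apply delta_derive_scal, C1rd_antiderivative; auto. }
  split; auto; apply C1rd_of_antiderivative with (2 := HA).
  apply rd_cont_plus; apply rd_cont_mult; try apply rd_cont_const.
  - apply H1.
  - apply H2.
Qed.

Lemma delta_derive_comb z1 z2 x1 x2 t : C1rd X z1 -> C1rd X z2 -> kappa X t ->
  delta_derive X (comb z1 z2 x1 x2) t =
  x1 * delta_derive X z1 t + x2 * delta_derive X z2 t.
Proof. intros H1 H2 Kt; apply delta_derive_eq, C1rd_comb; auto. Qed.

(** Written as the line y + e eta at e = 1, with eta = x1 z1 + x2 z2, so that the
    results on lines apply to it. *)
Definition perturb (y z1 z2 : R -> R) (x1 x2 : R) : R -> R :=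
  fun s => y s + 1 * comb z1 z2 x1 x2 s.

Lemma C1rd_perturb y z1 z2 x1 x2 : C1rd X y -> C1rd X z1 -> C1rd X z2 ->
  C1rd X (perturb y z1 z2 x1 x2).
Proof. intros; apply C1rd_lin; auto; apply C1rd_comb; auto. Qed.

Lemma perturb_0 y z1 z2 : perturb y z1 z2 0 0 = y.
Proof.
  apply functional_extensionality; intros t; unfold perturb, comb; ring.
Qed.

Section Lagrangian.

Variable L : R -> R -> R -> R.
Hypothesis L_lagrangian : lagrangian X L.
Hypothesis L_regular : regular X L.

Lemma lagrangian_differentiable t u v : kappa X t ->
  differentiable_pt_lim (L t) u v (partial_u L t u v) (partial_v L t u v).
Proof.
  intros Kt; destruct (proj1 L_lagrangian t u v Kt) as [lx [ly H]].
  destruct (differentiable_pt_lim_unique _ _ _ _ _ H) as [E1 E2].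
  unfold partial_u, partial_v; rewrite E1, E2; exact H.
Qed.

Lemma lagrangian_partials t u v : kappa X t ->
  is_derive (fun x => L t x v) u (partial_u L t u v) /\
  is_derive (fun x => L t u x) v (partial_v L t u v).
Proof.
  intros Kt; pose proof (lagrangian_differentiable t u v Kt) as H.
  split; apply is_derive_Reals.
  - replace (partial_u L t u v)
      with (partial_u L t u v * 1 + partial_v L t u v * 0) by ring.
    apply (derivable_pt_lim_comp_2d (L t) (fun x => x) (fun _ => v)); auto;
      apply is_derive_Reals; auto_derive; auto; ring.
  - replace (partial_v L t u v)
      with (partial_u L t u v * 0 + partial_v L t u v * 1) by ring.
    apply (derivable_pt_lim_comp_2d (L t) (fun _ => u) (fun x => x)); auto;
      apply is_derive_Reals; auto_derive; auto; ring.
Qed.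

Lemma along_line_derive y eta t : kappa X t ->
  Derive (along_line L y eta t) 0 = variation L y eta t.
Proof.
  intros Kt; apply is_derive_unique, is_derive_Reals.
  unfold along_line, variation, along.
  apply derivable_pt_lim_comp_2d.
  - replace (y (sigma X t) + 0 * eta (sigma X t)) with (y (sigma X t)) by ring.
    replace (delta_derive X y t + 0 * delta_derive X eta t)
      with (delta_derive X y t) by ring.
    apply lagrangian_differentiable, Kt.
  - apply is_derive_Reals; auto_derive; auto; ring.
  - apply is_derive_Reals; auto_derive; auto; ring.
Qed.

(** The mean value theorem in e: the regularity assumption makes the derivative
    vary by less than c for |e| < d, with the same d for every t. *)
Lemma along_line_expansion y eta c : C1rd X y -> C1rd X eta -> 0 < c ->
  exists d, 0 < d /\ forall t e, kappa X t -> Rabs e < d ->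
    Rabs (along_line L y eta t e - along X y L t - e * variation L y eta t)
      <= c * Rabs e.
Proof.
  intros Hy Heta Hc.
  destruct (L_regular y eta Hy Heta) as [Hex [Hu _]].
  assert (Hex1 : forall t e, kappa X t -> ex_derive (along_line L y eta t) e).
  { intros t e Kt; exact (proj1 (Hex t e Kt)). }
  change (unif_continuous_in_eps (kappa X)
    (fun t e => Derive (along_line L y eta t) e)) in Hu.
  destruct (Hu c Hc) as [d [Hd HH]]; exists d; split; auto; intros t e Kt He.
  destruct (MVT_gen (along_line L y eta t) 0 e (Derive (along_line L y eta t)))
    as [x [Hx E]].
  - intros x _; exact (Derive_correct _ _ (Hex1 t x Kt)).
  - intros x _; apply continuity_pt_filterlim.
    apply (ex_derive_continuous (K := R_AbsRing) (V := R_NormedModule)).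
    exact (Hex1 t x Kt).
  - replace (along X y L t) with (along_line L y eta t 0).
    2: { unfold along_line, along; f_equal; ring. }
    rewrite E, <- (along_line_derive y eta t Kt).
    replace (Derive (along_line L y eta t) x * (e - 0)
             - e * Derive (along_line L y eta t) 0)
      with ((Derive (along_line L y eta t) x
             - Derive (along_line L y eta t) 0) * e) by ring.
    rewrite Rabs_mult; apply Rmult_le_compat_r; [apply Rabs_pos|].
    left; apply HH; auto.
    eapply Rle_lt_trans; [|exact He].
    unfold Rmin, Rmax in Hx; destruct (Rle_dec 0 e).
    + rewrite !Rabs_pos_eq; lra.
    + rewrite !Rabs_left1; lra.
Qed.

Lemma functional_eq y F : is_antiderivative X (along X y L) F ->
  functional X a b L y = F b - F a.
Proof. intros HF; apply (delta_int_eq (along X y L)); auto; lra. Qed.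

(** The difference quotients of the integrand in e have antiderivatives and
    converge to the variation uniformly in t. *)
Lemma variation_integrable y eta : C1rd X y -> C1rd X eta ->
  exists F, is_antiderivative X (variation L y eta) F.
Proof.
  intros Hy Heta; apply antiderivative_of_approx; intros e He.
  destruct (along_line_expansion y eta (e / 2) Hy Heta ltac:(lra))
    as [d [Hd HH]].
  set (x := d / 2); assert (Hx : 0 < x) by (unfold x; lra).
  destruct (proj2 L_lagrangian y Hy) as [F0 HF0].
  destruct (proj2 L_lagrangian _ (proj2 (C1rd_lin y eta x Hy Heta))) as [F1 HF1].
  exists (fun s => / x * (F1 s - F0 s)).
  assert (HG : is_antiderivative X
    (fun t => / x * (along_line L y eta t x - along X y L t))
    (fun s => / x * (F1 s - F0 s))).
  { intros t Kt; apply delta_derive_scal, delta_derive_minus; auto.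
    rewrite <- along_line_eq by auto; apply HF1, Kt. }
  intros t Kt.
  destruct (antiderivative_approx _ _ (e / 2) HG ltac:(lra) t Kt) as [H1 H2].
  split; auto; apply near_slope_weaken with (1 := H1).
  specialize (HH t x Kt); rewrite (Rabs_pos_eq x) in HH by lra.
  specialize (HH ltac:(unfold x; lra)).
  replace (variation L y eta t - / x * (along_line L y eta t x - along X y L t))
    with (- / x * (along_line L y eta t x - along X y L t
                   - x * variation L y eta t)) by (field; lra).
  rewrite Rabs_mult, Rabs_Ropp, (Rabs_pos_eq (/ x))
    by (left; apply Rinv_0_lt_compat; lra).
  apply Rle_trans with (e / 2 + / x * (e / 2 * x)).
  - apply Rplus_le_compat_l, Rmult_le_compat_l; auto.
    left; apply Rinv_0_lt_compat; lra.
  - right; field; lra.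
Qed.

Lemma along_perturb y z1 z2 x1 x2 t :
  C1rd X y -> C1rd X z1 -> C1rd X z2 -> kappa X t ->
  along X (perturb y z1 z2 x1 x2) L t =
  L t (y (sigma X t) + (x1 * z1 (sigma X t) + x2 * z2 (sigma X t)))
    (delta_derive X y t + (x1 * delta_derive X z1 t + x2 * delta_derive X z2 t)).
Proof.
  intros Hy H1 H2 Kt; unfold perturb.
  rewrite along_line_eq; auto; [|apply C1rd_comb; auto].
  unfold along_line; rewrite delta_derive_comb by auto; unfold comb.
  rewrite !Rmult_1_l; reflexivity.
Qed.

(** Here d depends on p; the expansion is used at a single point. *)
Lemma perturb_expansion_at y z1 z2 c p :
  C1rd X y -> C1rd X z1 -> C1rd X z2 -> kappa X p -> 0 < c ->
  exists d, 0 < d /\ forall x1 x2, Rabs x1 < d -> Rabs x2 < d ->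
    Rabs (along X (perturb y z1 z2 x1 x2) L p - along X y L p
          - (x1 * variation L y z1 p + x2 * variation L y z2 p))
      <= c * (Rabs x1 + Rabs x2).
Proof.
  intros Hy H1 H2 Kp Hc.
  set (u1 := z1 (sigma X p)); set (u2 := z2 (sigma X p)).
  set (v1 := delta_derive X z1 p); set (v2 := delta_derive X z2 p).
  set (M := Rmax (Rabs u1) (Rabs v1) + Rmax (Rabs u2) (Rabs v2) + 1).
  pose proof (Rmax_l (Rabs u1) (Rabs v1)); pose proof (Rmax_r (Rabs u1) (Rabs v1)).
  pose proof (Rmax_l (Rabs u2) (Rabs v2)); pose proof (Rmax_r (Rabs u2) (Rabs v2)).
  pose proof (Rabs_pos u1); pose proof (Rabs_pos u2).
  assert (HM : 0 < M) by (unfold M; lra).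
  assert (Hcm : 0 < c / M) by (apply Rdiv_lt_0_compat; lra).
  destruct (lagrangian_differentiable p (y (sigma X p)) (delta_derive X y p) Kp
    (mkposreal _ Hcm)) as [d HH].
  simpl in HH.
  assert (Hd : 0 < d / (2 * M)).
  { apply Rdiv_lt_0_compat; [apply cond_pos|lra]. }
  assert (Hb : forall w1 w2 x1 x2, Rabs w1 <= Rmax (Rabs u1) (Rabs v1) ->
    Rabs w2 <= Rmax (Rabs u2) (Rabs v2) ->
    Rabs (x1 * w1 + x2 * w2) <= M * (Rabs x1 + Rabs x2)).
  { intros w1 w2 x1 x2 Hw1 Hw2.
    eapply Rle_trans; [apply Rabs_triang|]; rewrite !Rabs_mult.
    pose proof (Rabs_pos x1); pose proof (Rabs_pos x2).
    pose proof (Rabs_pos w1); pose proof (Rabs_pos w2).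
    assert (Rabs x1 * Rabs w1 <= Rabs x1 * M)
      by (apply Rmult_le_compat_l; unfold M; lra).
    assert (Rabs x2 * Rabs w2 <= Rabs x2 * M)
      by (apply Rmult_le_compat_l; unfold M; lra).
    lra. }
  exists (d / (2 * M)); split; auto; intros x1 x2 Hx1 Hx2.
  rewrite along_perturb by auto; fold u1 u2 v1 v2.
  set (x1u := x1 * u1 + x2 * u2); set (x1v := x1 * v1 + x2 * v2).
  assert (Hu : Rabs x1u <= M * (Rabs x1 + Rabs x2)) by (apply Hb; lra).
  assert (Hv : Rabs x1v <= M * (Rabs x1 + Rabs x2)) by (apply Hb; lra).
  assert (Hsm : M * (Rabs x1 + Rabs x2) < d).
  { replace (pos d) with (M * (d / (2 * M) + d / (2 * M))) by (field; lra).
    apply Rmult_lt_compat_l; lra. }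
  specialize (HH (y (sigma X p) + x1u) (delta_derive X y p + x1v)).
  replace (y (sigma X p) + x1u - y (sigma X p)) with x1u in HH by ring.
  replace (delta_derive X y p + x1v - delta_derive X y p) with x1v in HH by ring.
  specialize (HH ltac:(lra) ltac:(lra)).
  unfold variation; fold u1 u2 v1 v2.
  eapply Rle_trans; [|eapply Rle_trans; [exact HH|]].
  - right; f_equal; unfold x1u, x1v, along; ring.
  - replace (c * (Rabs x1 + Rabs x2)) with (c / M * (M * (Rabs x1 + Rabs x2)))
      by (field; lra).
    apply Rmult_le_compat_l; [lra|]; apply Rmax_lub; auto.
Qed.

(** The pair (z^sigma, z^Delta) at t is all that a functional sees of z at t. *)
Definition jets_meet_only_at (p : R) (z1 z2 : R -> R) : Prop :=
  forall t, kappa X t -> t <> p ->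
    (z1 (sigma X t) = 0 /\ delta_derive X z1 t = 0) \/
    (z2 (sigma X t) = 0 /\ delta_derive X z2 t = 0).

(** Off p the expansion of the integrand along one of the two lines applies, with
    an error uniform in t; at p total differentiability does. The mean value
    inequality then transfers the pointwise error to the integrals. *)
Lemma functional_has_gradient y z1 z2 v1 v2 p :
  C1rd X y -> C1rd X z1 -> C1rd X z2 -> jets_meet_only_at p z1 z2 ->
  has_int (variation L y z1) v1 -> has_int (variation L y z2) v2 ->
  has_gradient (fun x1 x2 => functional X a b L (perturb y z1 z2 x1 x2)) v1 v2.
Proof.
  intros Hy H1 H2 Hp [V1 [HV1 E1]] [V2 [HV2 E2]] c Hc; rewrite perturb_0.
  set (c' := c / (b - a)).
  assert (Hc' : 0 < c') by (apply Rdiv_lt_0_compat; lra).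
  destruct (along_line_expansion y z1 c' Hy H1 Hc') as [d1 [Hd1 K1]].
  destruct (along_line_expansion y z2 c' Hy H2 Hc') as [d2 [Hd2 K2]].
  assert (HP : exists d, 0 < d /\ forall x1 x2, kappa X p ->
    Rabs x1 < d -> Rabs x2 < d ->
    Rabs (along X (perturb y z1 z2 x1 x2) L p - along X y L p
          - (x1 * variation L y z1 p + x2 * variation L y z2 p))
      <= c' * (Rabs x1 + Rabs x2)).
  { destruct (classic (kappa X p)) as [Kp|Kp].
    - destruct (perturb_expansion_at y z1 z2 c' p Hy H1 H2 Kp Hc')
        as [d [Hd HH]].
      exists d; auto.
    - exists 1; split; [lra|]; intros; contradiction. }
  destruct HP as [d3 [Hd3 K3]].
  exists (Rmin d1 (Rmin d2 d3)); split; [repeat apply Rmin_pos; lra|].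
  intros x1 x2 Hx1 Hx2.
  pose proof (Rmin_l d1 (Rmin d2 d3)); pose proof (Rmin_r d1 (Rmin d2 d3)).
  pose proof (Rmin_l d2 d3); pose proof (Rmin_r d2 d3).
  pose proof (Rabs_pos x1) as P1; pose proof (Rabs_pos x2) as P2.
  destruct (proj2 L_lagrangian y Hy) as [F0 HF0].
  destruct (proj2 L_lagrangian _ (C1rd_perturb y z1 z2 x1 x2 Hy H1 H2))
    as [F1 HF1].
  rewrite (functional_eq _ _ HF0), (functional_eq _ _ HF1).
  pose proof (antiderivative_diff
    (fun t => along X (perturb y z1 z2 x1 x2) L t - along X y L t)
    (fun t => x1 * variation L y z1 t + x2 * variation L y z2 t)
    (fun s => F1 s - F0 s) (fun s => x1 * V1 s + x2 * V2 s)
    (c' * (Rabs x1 + Rabs x2)) a b) as HD.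
  replace (F1 b - F1 a - (F0 b - F0 a) - (x1 * v1 + x2 * v2)) with
    (F1 b - F0 b - (F1 a - F0 a)
     - (x1 * V1 b + x2 * V2 b - (x1 * V1 a + x2 * V2 a)))
    by (rewrite E1, E2; ring).
  replace (c * (Rabs x1 + Rabs x2)) with (c' * (Rabs x1 + Rabs x2) * (b - a))
    by (unfold c'; field; lra).
  apply HD; auto; clear HD.
  - intros t Kt; apply delta_derive_minus; auto.
  - intros t Kt; apply (delta_derive_plus (fun s => x1 * V1 s) (fun s => x2 * V2 s));
      apply delta_derive_scal; auto.
  - apply Rmult_le_pos; lra.
  - lra.
  - intros t Kt _.
    destruct (Req_dec t p) as [->|Htp]; [apply K3; auto; lra|].
    (* off p only one of the two directions is seen *)
    destruct (Hp t Kt Htp) as [[Zu Zv]|[Zu Zv]].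
    + specialize (K2 t x2 Kt ltac:(lra)).
      eapply Rle_trans; [|eapply Rle_trans; [exact K2|]].
      * right; f_equal; rewrite along_perturb by auto.
        unfold along_line, variation at 1; rewrite Zu, Zv.
        rewrite !Rmult_0_r, !Rplus_0_l, Rmult_0_r, Rplus_0_l; reflexivity.
      * apply Rmult_le_compat_l; lra.
    + specialize (K1 t x1 Kt ltac:(lra)).
      eapply Rle_trans; [|eapply Rle_trans; [exact K1|]].
      * right; f_equal; rewrite along_perturb by auto.
        unfold along_line, variation at 2; rewrite Zu, Zv.
        rewrite !Rmult_0_r, !Rplus_0_r, Rmult_0_r, Rplus_0_r; reflexivity.
      * apply Rmult_le_compat_l; lra.
Qed.

(** A point of the line is taken as a new base function, and
    [functional_has_gradient] is applied there with the second direction zero. *)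
Lemma functional_line_continuous y z1 z2 p1 p2 q1 q2 :
  C1rd X y -> C1rd X z1 -> C1rd X z2 ->
  continuity (fun s =>
    functional X a b L (perturb y z1 z2 (p1 + s * q1) (p2 + s * q2))).
Proof.
  intros Hy H1 H2 s.
  set (y' := perturb y z1 z2 (p1 + s * q1) (p2 + s * q2)).
  set (z := comb z1 z2 q1 q2).
  assert (Hy' : C1rd X y') by (apply C1rd_perturb; auto).
  assert (Hz : C1rd X z) by (apply C1rd_comb; auto).
  pose proof (C1rd_linear 0 0) as H0.
  destruct (variation_integrable y' z Hy' Hz) as [V HV].
  destruct (variation_integrable y' _ Hy' H0) as [V0 HV0].
  assert (Hj : jets_meet_only_at a z (fun t => 0 + 0 * t)).
  { intros t Kt _; right; split; [ring|].
    apply delta_derive_eq, delta_derive_linear; auto. }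
  intros e He.
  destruct (functional_has_gradient y' z (fun t => 0 + 0 * t) (V b - V a)
    (V0 b - V0 a) a Hy' Hz H0 Hj (ex_intro _ V (conj HV eq_refl))
    (ex_intro _ V0 (conj HV0 eq_refl)) 1 Rlt_0_1) as [d [Hd HH]].
  rewrite perturb_0 in HH.
  set (K := Rabs (V b - V a) + 2).
  assert (HK : 0 < K) by (unfold K; pose proof (Rabs_pos (V b - V a)); lra).
  assert (Hek : 0 < e / K) by (apply Rdiv_lt_0_compat; lra).
  exists (Rmin d (e / K)); split; [apply Rmin_pos; lra|].
  intros x [_ Hx]; simpl in *; unfold Rdist in *.
  pose proof (Rlt_le_trans _ _ _ Hx (Rmin_l _ _)) as Hx1.
  pose proof (Rlt_le_trans _ _ _ Hx (Rmin_r _ _)) as Hx2.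
  specialize (HH (x - s) 0 Hx1); rewrite Rabs_R0 in HH; specialize (HH Hd).
  assert (E : perturb y' z (fun t => 0 + 0 * t) (x - s) 0
    = perturb y z1 z2 (p1 + x * q1) (p2 + x * q2)).
  { apply functional_extensionality; intros r.
    unfold perturb, comb, y', z, perturb, comb; ring. }
  rewrite E in HH; fold y'.
  set (A := functional X a b L (perturb y z1 z2 (p1 + x * q1) (p2 + x * q2))) in *.
  set (B := functional X a b L y') in *.
  replace (A - B) with ((A - B - ((x - s) * (V b - V a) + 0 * (V0 b - V0 a)))
    + (x - s) * (V b - V a)) by ring.
  eapply Rle_lt_trans; [apply Rabs_triang|]; rewrite Rabs_mult.
  apply Rle_lt_trans with (K * Rabs (x - s)).
  { unfold K; pose proof (Rabs_pos (x - s)); lra. }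
  replace e with (K * (e / K)) by (field; lra).
  apply Rmult_lt_compat_l; lra.
Qed.

End Lagrangian.

(** * Reduction of the first variation *)

Section DuBoisReymond.

Variables (L : R -> R -> R -> R) (y P : R -> R).
Hypothesis L_lagrangian : lagrangian X L.
Hypothesis L_regular : regular X L.
Hypothesis y_C1rd : C1rd X y.
Hypothesis P_primitive : is_antiderivative X (along X y (partial_u L)) P.

(** The function whose constancy is the integrated Euler-Lagrange equation of
    L. *)
Definition reduced (t : R) : R := along X y (partial_v L) t - P t.

Lemma reduced_antiderivative eta F : C1rd X eta ->
  is_antiderivative X (variation L y eta) F ->
  is_antiderivative X (fun t => reduced t * delta_derive X eta t)
    (fun t => F t - P t * eta t).
Proof.
  intros Heta HF t Kt.
  replace (reduced t * delta_derive X eta t) with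
    (variation L y eta t - (along X y (partial_u L) t * eta (sigma X t)
                            + P t * delta_derive X eta t))
    by (unfold variation, reduced; ring).
  apply (delta_derive_minus F (fun t => P t * eta t)); auto.
  apply delta_derive_mult; auto using kappa_X.
  apply C1rd_antiderivative; auto.
Qed.

(** Every rd-continuous h is the Delta-derivative of some eta, and
    (L_v - P) eta^Delta is the difference of the variation in the direction eta
    and of the Delta-derivative of P eta. *)
Lemma reduced_multipliable : rd_multipliable reduced.
Proof.
  intros h Hh; destruct (rd_cont_antiderivative h Hh) as [eta Heta].
  pose proof (C1rd_of_antiderivative h eta Hh Heta) as Ceta.
  destruct (variation_integrable L L_lagrangian L_regular y eta y_C1rd Ceta)
    as [F HF].
  eexists; exists (fun t => F t - P t * eta t); split; [|reflexivity].
  apply antiderivative_ext with (1 := reduced_antiderivative eta F Ceta HF).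
  intros t Kt; rewrite (delta_derive_eq eta t (h t)); auto.
Qed.

Lemma variation_int_reduced eta v : C1rd X eta -> eta a = 0 -> eta b = 0 ->
  has_int (fun t => reduced t * delta_derive X eta t) v ->
  has_int (variation L y eta) v.
Proof.
  intros Ceta Ha Hb Hv.
  destruct (variation_integrable L L_lagrangian L_regular y eta y_C1rd Ceta)
    as [F HF].
  exists F; split; auto.
  apply (has_int_unique _ v (F b - F a)) in Hv; auto.
  eexists; split; [exact (reduced_antiderivative eta F Ceta HF)|].
  cbv beta; rewrite Ha, Hb; ring.
Qed.

End DuBoisReymond.

Lemma partial_u_integrable L y : lagrangian X L -> regular X L -> C1rd X y ->
  exists P, is_antiderivative X (along X y (partial_u L)) P.
Proof.
  intros HL HR Hy; pose proof (C1rd_linear 1 0) as H1.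
  destruct (variation_integrable L HL HR y _ Hy H1) as [P HP].
  exists P; apply antiderivative_ext with (1 := HP); intros t Kt.
  unfold variation; rewrite (delta_derive_eq _ _ _ Kt (delta_derive_linear 1 0 t)).
  ring.
Qed.

(** * Collinearity of the reduced integrands *)

Lemma rd_multipliable_lin c d w1 w2 :
  rd_multipliable w1 -> rd_multipliable w2 ->
  rd_multipliable (fun t => c * w1 t + d * w2 t).
Proof.
  intros H1 H2 h Hh; destruct (H1 h Hh) as [v1 V1], (H2 h Hh) as [v2 V2].
  exists (c * v1 + d * v2).
  pose proof (has_int_plus _ _ _ _ (has_int_scal c _ _ V1) (has_int_scal d _ _ V2)).
  revert H; apply has_int_ext; intros; ring.
Qed.

Definition vanishing (z : R -> R) : Prop := C1rd X z /\ z a = 0 /\ z b = 0.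

(** First-order form of the multiplier rule, on the pairs of test functions for
    which it can be derived from [functional_has_gradient]. *)
Definition parallel_on_tests (w1 w2 : R -> R) : Prop :=
  forall p z1 z2 i1 i2 j1 j2, vanishing z1 -> vanishing z2 ->
  jets_meet_only_at p z1 z2 ->
  has_int (fun t => w1 t * delta_derive X z1 t) i1 ->
  has_int (fun t => w1 t * delta_derive X z2 t) i2 ->
  has_int (fun t => w2 t * delta_derive X z1 t) j1 ->
  has_int (fun t => w2 t * delta_derive X z2 t) j2 ->
  i1 * j2 = i2 * j1.

Lemma vanishing_test h : rd_cont h -> has_int h 0 ->
  exists z, vanishing z /\ is_antiderivative X h z.
Proof.
  intros Hh [F [HF E]]; exists (fun t => - F a + 1 * F t).
  assert (HA : is_antiderivative X h (fun t => - F a + 1 * F t)).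
  { intros t Kt; replace (h t) with (0 + 1 * h t) by ring.
    apply (delta_derive_plus (fun _ => - F a) (fun t => 1 * F t)).
    - apply delta_derive_ext with (fun s => - F a + 0 * s);
        auto using kappa_X, delta_derive_linear.
      intros; ring.
    - apply delta_derive_scal, HF, Kt. }
  split; auto; split; [|split]; [|ring|lra].
  apply C1rd_of_antiderivative with h; auto.
Qed.

(** Weights on the two sides of p. If p is right-scattered both are positive at
    p, and p is the only such point; if p is right-dense they are never positive
    together. *)
Definition before (p t : R) : R := Rmax 0 (sigma X p - t).
Definition after (p t : R) : R := Rmax 0 (sigma X t - p).

Lemma rd_cont_before p : rd_cont (before p).
Proof.
  apply rd_cont_continuous; intros t _ e He; exists e; split; auto.
  intros s _ Hs; unfold before; apply Rabs_def2 in Hs.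
  apply Rabs_def1; unfold Rmax;
    destruct (Rle_dec 0 (sigma X p - s)), (Rle_dec 0 (sigma X p - t)); lra.
Qed.

Lemma rd_cont_after p : rd_cont (after p).
Proof.
  apply (rd_cont_comp_sigma (fun s => Rmax 0 (s - p))).
  intros t _ e He; exists e; split; auto.
  intros s _ Hs; apply Rabs_def2 in Hs.
  apply Rabs_def1; unfold Rmax;
    destruct (Rle_dec 0 (s - p)), (Rle_dec 0 (t - p)); lra.
Qed.

(** To the right of p the first test function has derivative zero and ends at
    zero, so it is zero; to the left of p the second one starts at zero and has
    derivative zero. *)
Lemma before_after_jets p h1 h2 z1 z2 :
  X p -> vanishing z1 -> vanishing z2 ->
  is_antiderivative X (fun t => before p t * h1 t) z1 ->
  is_antiderivative X (fun t => after p t * h2 t) z2 ->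
  jets_meet_only_at p z1 z2.
Proof.
  intros Xp [_ [_ Hb1]] [_ [Ha2 _]] H1 H2 t Kt Htp; pose proof (kappa_X t Kt) as Xt.
  pose proof (X_bounds _ (X_sigma t Xt)) as Hsb.
  assert (H0 : is_antiderivative X (fun _ => 0) (fun s => 0 + 0 * s)).
  { intros s _; apply delta_derive_linear. }
  assert (Z1 : forall s, X s -> p < s -> before p s = 0).
  { intros s Xs Hs; pose proof (sigma_le p s Xp Xs Hs).
    unfold before; apply Rmax_left; lra. }
  assert (Z2 : forall s, X s -> s < p -> after p s = 0).
  { intros s Xs Hs; pose proof (sigma_le s p Xs Xp Hs).
    unfold after; apply Rmax_left; lra. }
  destruct (Rlt_le_dec p t) as [Hlt|Hle]; [left|right; assert (t < p) by lra].
  - split.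
    + pose proof (antiderivative_unique _ _ z1 _ (sigma X t) b H1 H0
        (X_sigma t Xt) X_b (proj2 Hsb)) as E.
      rewrite Hb1 in E.
      cut (0 - z1 (sigma X t) = 0); [lra|].
      rewrite E; [ring|]; intros s Ks Hs; pose proof (sigma_ge t Xt).
      rewrite Z1; [ring|apply kappa_X, Ks|lra].
    + apply delta_derive_eq; auto.
      replace 0 with (before p t * h1 t); [apply H1, Kt|].
      rewrite Z1 by auto; ring.
  - split.
    + pose proof (antiderivative_unique _ _ z2 _ a (sigma X t) H2 H0
        X_a (X_sigma t Xt) (proj1 Hsb)) as E.
      rewrite Ha2 in E.
      cut (z2 (sigma X t) - 0 = 0); [lra|].
      rewrite E; [ring|]; intros s Ks Hs; pose proof (sigma_le t p Xt Xp H).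
      rewrite Z2; [ring|apply kappa_X, Ks|lra].
    + apply delta_derive_eq; auto.
      replace 0 with (after p t * h2 t); [apply H2, Kt|].
      rewrite Z2 by auto; ring.
Qed.

Section Collinear.

Variables w1 w2 : R -> R.
Hypothesis w1_mult : rd_multipliable w1.
Hypothesis w2_mult : rd_multipliable w2.
Hypothesis w_parallel : parallel_on_tests w1 w2.

Lemma has_int_congr w h z v : is_antiderivative X h z ->
  has_int (fun t => w t * h t) v ->
  has_int (fun t => w t * delta_derive X z t) v.
Proof.
  intros Hz; apply has_int_ext; intros t Kt.
  rewrite (delta_derive_eq z t (h t)); auto.
Qed.

(** For a fixed test function on the left of p, parallelism makes the combination
    i1 w2 - j1 w1 orthogonal to all test functions on the right, hence constant
    there. The resulting relation between i1 and j1, which holds for every test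
    function on the left, says in turn that N2 w1 - N1 w2 is orthogonal to all of
    these, hence constant on the left. *)
Lemma parallel_chords p s s' r r' : X p ->
  kappa X s -> kappa X s' -> kappa X r -> kappa X r' ->
  s < sigma X p -> s' < sigma X p -> p < sigma X r -> p < sigma X r' ->
  (w1 s - w1 s') * (w2 r - w2 r') = (w2 s - w2 s') * (w1 r - w1 r').
Proof.
  intros Xp Ks Ks' Kr Kr' Hs Hs' Hr Hr'.
  set (N1 := w1 r - w1 r'); set (N2 := w2 r - w2 r').
  assert (Hpos1 : forall t, kappa X t -> 0 <= before p t)
    by (intros; apply Rmax_l).
  assert (Hpos2 : forall t, kappa X t -> 0 <= after p t)
    by (intros; apply Rmax_l).
  cut (N2 * w1 s + (- N1) * w2 s = N2 * w1 s' + (- N1) * w2 s').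
  { intros E; lra. }
  apply (du_bois_reymond (fun t => N2 * w1 t + (- N1) * w2 t) (before p));
    auto using rd_multipliable_lin, rd_cont_before.
  2, 3: unfold before; rewrite Rmax_right; lra.
  intros h1 Hh1 Hint1.
  pose proof (rd_cont_mult _ _ (rd_cont_before p) Hh1) as Hb1.
  destruct (vanishing_test _ Hb1 Hint1) as [z1 [Vz1 Hz1]].
  destruct (w1_mult _ Hb1) as [i1 I1]; destruct (w2_mult _ Hb1) as [j1 J1].
  assert (E : i1 * w2 r + (- j1) * w1 r = i1 * w2 r' + (- j1) * w1 r').
  { apply (du_bois_reymond (fun t => i1 * w2 t + (- j1) * w1 t) (after p));
      auto using rd_multipliable_lin, rd_cont_after.
    2, 3: unfold after; rewrite Rmax_right; lra.
    intros h2 Hh2 Hint2.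
    pose proof (rd_cont_mult _ _ (rd_cont_after p) Hh2) as Hb2.
    destruct (vanishing_test _ Hb2 Hint2) as [z2 [Vz2 Hz2]].
    destruct (w1_mult _ Hb2) as [i2 I2]; destruct (w2_mult _ Hb2) as [j2 J2].
    assert (Eij : i1 * j2 = i2 * j1).
    { apply (w_parallel p z1 z2); auto.
      - apply before_after_jets with h1 h2; auto.
      - exact (has_int_congr _ _ _ _ Hz1 I1).
      - exact (has_int_congr _ _ _ _ Hz2 I2).
      - exact (has_int_congr _ _ _ _ Hz1 J1).
      - exact (has_int_congr _ _ _ _ Hz2 J2). }
    pose proof (has_int_plus _ _ _ _ (has_int_scal i1 _ _ J2)
      (has_int_scal (- j1) _ _ I2)) as H.
    replace (i1 * j2 + - j1 * i2) with 0 in H by lra.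
    revert H; apply has_int_ext; intros; ring. }
  pose proof (has_int_plus _ _ _ _ (has_int_scal N2 _ _ I1)
    (has_int_scal (- N1) _ _ J1)) as H.
  replace (N2 * i1 + - N1 * j1) with 0 in H by (unfold N1, N2; lra).
  revert H; apply has_int_ext; intros; ring.
Qed.

(** The antiderivative of w has slope c to the right of t, hence also at t by
    continuity. *)
Lemma right_dense_value w c t u : rd_multipliable w ->
  X t -> t < b -> sigma X t = t -> t < u ->
  (forall x, kappa X x -> t < x < u -> w x = c) -> w t = c.
Proof.
  intros Hw Xt Htb Et Htu Hc.
  destruct (Hw _ (rd_cont_const 1)) as [v [W [HW _]]].
  assert (HW' : is_antiderivative X w W).
  { apply antiderivative_ext with (1 := HW); intros; ring. }
  pose proof (kappa_lt t Xt Htb) as Kt.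
  apply NNPP; intros Hne.
  set (e := Rabs (w t - c) / 4).
  assert (He : 0 < e).
  { assert (0 < Rabs (w t - c)) by (apply Rabs_pos_lt; lra); unfold e; lra. }
  destruct (HW' t Kt e He) as [d [Hd HH]].
  destruct (right_dense_points t (Rmin d (u - t)) Xt Htb Et) as [s [Xs Hs]].
  { apply Rmin_pos; lra. }
  pose proof (Rmin_l d (u - t)); pose proof (Rmin_r d (u - t)).
  specialize (HH s Xs); rewrite Et, (Rabs_pos_eq (s - t)) in HH by lra.
  specialize (HH ltac:(lra)); rewrite (Rabs_left (t - s)) in HH by lra.
  assert (Hes : 0 < e * (s - t)) by (apply Rmult_lt_0_compat; lra).
  destruct (delta_derive_cont W t _ Xt (HW' t Kt) (e * (s - t)) Hes)
    as [d1 [Hd1 H1]].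
  assert (Hcc : 0 < Rabs c + 1) by (pose proof (Rabs_pos c); lra).
  assert (Hq : 0 < e * (s - t) / (Rabs c + 1)) by (apply Rdiv_lt_0_compat; lra).
  destruct (right_dense_points t
    (Rmin (s - t) (Rmin d1 (e * (s - t) / (Rabs c + 1)))) Xt Htb Et)
    as [r [Xr Hr]].
  { repeat apply Rmin_pos; lra. }
  pose proof (Rmin_l (s - t) (Rmin d1 (e * (s - t) / (Rabs c + 1)))).
  pose proof (Rmin_r (s - t) (Rmin d1 (e * (s - t) / (Rabs c + 1)))).
  pose proof (Rmin_l d1 (e * (s - t) / (Rabs c + 1))).
  pose proof (Rmin_r d1 (e * (s - t) / (Rabs c + 1))).
  specialize (H1 r Xr); rewrite (Rabs_pos_eq (r - t)) in H1 by lra.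
  specialize (H1 ltac:(lra)).
  assert (E : W s - W r = (0 + c * s) - (0 + c * r)).
  { apply (antiderivative_unique w (fun _ => c) W (fun x => 0 + c * x)); auto; [|lra|].
    - intros x _; apply delta_derive_linear.
    - intros x Kx Hx; apply Hc; auto; lra. }
  assert (Hcr : Rabs (c * (r - t)) <= e * (s - t)).
  { rewrite Rabs_mult, (Rabs_pos_eq (r - t)) by lra.
    apply Rle_trans with ((Rabs c + 1) * (e * (s - t) / (Rabs c + 1))).
    - apply Rmult_le_compat; try lra; apply Rabs_pos.
    - right; field; lra. }
  assert (Hfin : Rabs ((w t - c) * (s - t)) <= 3 * (e * (s - t))).
  { replace ((w t - c) * (s - t)) with
      ((W t - W s - w t * (t - s)) + ((W r - W t) + - (c * (r - t))))
      by (replace (W s) with (W r + c * (s - r)) by lra; ring).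
    eapply Rle_trans; [apply Rabs_triang|].
    eapply Rle_trans; [apply Rplus_le_compat_l, Rabs_triang|].
    rewrite Rabs_Ropp; lra. }
  rewrite Rabs_mult, (Rabs_pos_eq (s - t)) in Hfin by lra.
  assert (Rabs (w t - c) <= 3 * e).
  { apply Rmult_le_reg_r with (s - t); lra. }
  unfold e in *; lra.
Qed.

Lemma collinear_ordered t1 t2 t3 : kappa X t1 -> kappa X t2 -> kappa X t3 ->
  t1 < t2 -> t2 < t3 ->
  (w1 t1 - w1 t2) * (w2 t2 - w2 t3) = (w2 t1 - w2 t2) * (w1 t2 - w1 t3).
Proof.
  intros K1 K2 K3 H12 H23; pose proof (kappa_X t2 K2) as X2.
  pose proof (sigma_ge t2 X2); pose proof (sigma_ge t3 (kappa_X t3 K3)).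
  destruct (Req_dec (sigma X t2) t2) as [E|Hne].
  - set (D1 := w1 t1 - w1 t2); set (D2 := w2 t1 - w2 t2).
    assert (Hb : t2 < b) by (apply kappa_X, X_bounds in K3; lra).
    cut (D1 * w2 t2 + (- D2) * w1 t2 = D1 * w2 t3 + (- D2) * w1 t3); [lra|].
    apply (right_dense_value (fun t => D1 * w2 t + (- D2) * w1 t)
      (D1 * w2 t3 + (- D2) * w1 t3) t2 t3); auto using rd_multipliable_lin.
    intros x Kx Hx.
    destruct (right_dense_points t2 (x - t2) X2 Hb E ltac:(lra)) as [p [Xp Hp]].
    pose proof (sigma_ge p Xp); pose proof (sigma_ge x (kappa_X x Kx)).
    pose proof (parallel_chords p t1 t2 x t3 Xp K1 K2 Kx K3) as HC.
    fold D1 D2 in HC; cut (D1 * (w2 x - w2 t3) = D2 * (w1 x - w1 t3)); [lra|].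
    apply HC; lra.
  - apply (parallel_chords t2); auto; lra.
Qed.

Lemma collinear s r t : kappa X s -> kappa X r -> kappa X t ->
  (w1 s - w1 r) * (w2 t - w2 r) = (w2 s - w2 r) * (w1 t - w1 r).
Proof.
  intros Ks Kr Kt.
  destruct (Rtotal_order s r) as [H1|[->|H1]]; [|ring|];
  destruct (Rtotal_order r t) as [H2|[->|H2]]; try ring;
  destruct (Rtotal_order s t) as [H3|[->|H3]]; try ring; try lra.
  - pose proof (collinear_ordered s r t Ks Kr Kt H1 H2); lra.
  - pose proof (collinear_ordered s t r Ks Kt Kr H3 H2); lra.
  - pose proof (collinear_ordered t s r Kt Ks Kr H3 H1); lra.
  - pose proof (collinear_ordered r s t Kr Ks Kt H1 H3); lra.
  - pose proof (collinear_ordered r t s Kr Kt Ks H2 H3); lra.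
  - pose proof (collinear_ordered t r s Kt Kr Ks H2 H1); lra.
Qed.

End Collinear.

(** * The multiplier *)

Lemma sup_kappa_le f m :
  (forall t, kappa X t -> Rabs (f t) <= m) -> Rbar_le (sup_kappa X f) m.
Proof.
  intros H; apply Lub_Rbar_correct; intros x [t [Kt ->]]; exact (H t Kt).
Qed.

(** rd-continuous functions are bounded, so the seminorms of z1 and z2 are
    finite. *)
Lemma C1rd_norm_perturb y z1 z2 delta : C1rd X z1 -> C1rd X z2 -> 0 < delta ->
  exists d, 0 < d /\ forall x1 x2, Rabs x1 < d -> Rabs x2 < d ->
    Rbar_lt (C1rd_norm X (fun t => perturb y z1 z2 x1 x2 t - y t)) delta.
Proof.
  intros H1 H2 Hdelta.
  assert (Hs : forall z, C1rd X z -> exists M, 0 <= M /\ forall t, kappa X t ->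
    Rabs (z (sigma X t)) <= M /\ Rabs (delta_derive X z t) <= M).
  { intros z Hz.
    destruct (rd_cont_bounded (fun t => z (sigma X t))) as [M1 HM1].
    { apply rd_cont_comp_sigma; intros t Kt.
      apply (delta_derive_cont z t _ (kappa_X t Kt) (C1rd_antiderivative z Hz t Kt)). }
    destruct (rd_cont_bounded (delta_derive X z)) as [M2 HM2]; [apply Hz|].
    exists (Rmax M1 M2); split.
    - eapply Rle_trans; [|apply Rmax_l].
      eapply Rle_trans; [apply Rabs_pos|apply (HM1 a kappa_a)].
    - intros t Kt; split.
      + eapply Rle_trans; [apply HM1, Kt|apply Rmax_l].
      + eapply Rle_trans; [apply HM2, Kt|apply Rmax_r]. }
  destruct (Hs z1 H1) as [M1 [P1 B1]]; destruct (Hs z2 H2) as [M2 [P2 B2]].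
  set (d := delta / (4 * (M1 + M2 + 1))).
  assert (Hd : 0 < d) by (apply Rdiv_lt_0_compat; lra).
  assert (Hdm : d * (M1 + M2) < delta / 4).
  { replace (delta / 4) with (d * (M1 + M2 + 1)) by (unfold d; field; lra).
    apply Rmult_lt_compat_l; lra. }
  exists d; split; auto; intros x1 x2 Hx1 Hx2.
  replace (fun t => perturb y z1 z2 x1 x2 t - y t) with (comb z1 z2 x1 x2).
  2: { apply functional_extensionality; intros t; unfold perturb; ring. }
  assert (Hc : forall u1 u2, Rabs u1 <= M1 -> Rabs u2 <= M2 ->
    Rabs (x1 * u1 + x2 * u2) <= delta / 4).
  { intros u1 u2 Hu1 Hu2.
    eapply Rle_trans; [apply Rabs_triang|]; rewrite !Rabs_mult.
    assert (Rabs x1 * Rabs u1 <= d * M1)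
      by (apply Rmult_le_compat; try apply Rabs_pos; lra).
    assert (Rabs x2 * Rabs u2 <= d * M2)
      by (apply Rmult_le_compat; try apply Rabs_pos; lra).
    lra. }
  unfold C1rd_norm.
  apply Rbar_le_lt_trans with (Rbar_plus (delta / 4) (delta / 4)).
  - apply Rbar_plus_le_compat; apply sup_kappa_le; intros t Kt.
    + apply Hc; [apply B1|apply B2]; auto.
    + rewrite delta_derive_comb by auto; apply Hc; [apply B1|apply B2]; auto.
  - simpl; lra.
Qed.

Section Minimum.

Variables (L g : R -> R -> R -> R) (ys PL Pg : R -> R) (ya yb l : R).
Hypothesis L_lagrangian : lagrangian X L.
Hypothesis g_lagrangian : lagrangian X g.
Hypothesis L_regular : regular X L.
Hypothesis g_regular : regular X g.
Hypothesis ys_minimum : local_minimum X a b ya yb l L g ys.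
Hypothesis PL_primitive : is_antiderivative X (along X ys (partial_u L)) PL.
Hypothesis Pg_primitive : is_antiderivative X (along X ys (partial_u g)) Pg.

Lemma minimum_C1rd : C1rd X ys.
Proof. apply ys_minimum. Qed.

Lemma minimum_parallel : parallel_on_tests (reduced g ys Pg) (reduced L ys PL).
Proof.
  intros p z1 z2 i1 i2 j1 j2 [C1 [A1 B1]] [C2 [A2 B2]] Hp I1 I2 J1 J2.
  pose proof minimum_C1rd as Cy.
  apply (constrained_minimum_gradients
    (fun x1 x2 => functional X a b g (perturb ys z1 z2 x1 x2))
    (fun x1 x2 => functional X a b L (perturb ys z1 z2 x1 x2))).
  - apply functional_has_gradient with p; auto;
      apply variation_int_reduced with Pg; auto.
  - apply functional_has_gradient with p; auto;
      apply variation_int_reduced with PL; auto.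
  - intros p1 p2 q1 q2; apply functional_line_continuous; auto.
  - destruct ys_minimum as [[_ [Ya [Yb Yl]]] [delta [Hdelta Hmin]]].
    destruct (C1rd_norm_perturb ys z1 z2 delta C1 C2 Hdelta) as [d [Hd HH]].
    exists d; split; auto; intros x1 x2 Hx1 Hx2 E.
    rewrite perturb_0 in E |- *; apply Hmin; auto.
    split; [|split; [|split]].
    + apply C1rd_perturb; auto.
    + unfold perturb, comb; rewrite A1, A2, Ya; ring.
    + unfold perturb, comb; rewrite B1, B2, Yb; ring.
    + rewrite E; exact Yl.
Qed.

Lemma not_extremal_reduced : ~ extremal X a g ys ->
  exists s r, kappa X s /\ kappa X r /\ reduced g ys Pg s <> reduced g ys Pg r.
Proof.
  intros Hext; apply NNPP; intros Hn; apply Hext.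
  exists (reduced g ys Pg a + Pg a); intros t Kt; pose proof (kappa_X t Kt) as Xt.
  rewrite (delta_int_eq _ Pg a t Pg_primitive X_a Xt (proj1 (X_bounds t Xt))).
  assert (E : reduced g ys Pg t = reduced g ys Pg a).
  { apply NNPP; intros Hne; apply Hn; exists t, a; auto using kappa_a. }
  unfold reduced in *; lra.
Qed.

Lemma multiplier_exists : ~ extremal X a g ys ->
  exists lambda c, forall t, kappa X t ->
    reduced L ys PL t - lambda * reduced g ys Pg t = c.
Proof.
  intros Hext; destruct (not_extremal_reduced Hext) as [s [r [Ks [Kr Hne]]]].
  set (wg := reduced g ys Pg) in *; set (wL := reduced L ys PL).
  exists ((wL s - wL r) / (wg s - wg r)).
  exists (wL r - (wL s - wL r) / (wg s - wg r) * wg r); intros t Kt.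
  assert (HC : (wg s - wg r) * (wL t - wL r) = (wL s - wL r) * (wg t - wg r)).
  { pose proof minimum_C1rd as Cy.
    apply collinear; auto; unfold wg, wL.
    - apply reduced_multipliable; auto.
    - apply reduced_multipliable; auto.
    - exact minimum_parallel. }
  replace (wL t) with (wL r + (wL s - wL r) * (wg t - wg r) / (wg s - wg r)).
  - field; lra.
  - rewrite <- HC; field; lra.
Qed.

End Minimum.

(** The function c + P_L - lambda P_g equals F_v on [kappa X] and is
    Delta-differentiable at each of its points, so that the equation holds on
    all of [kappa X]. *)
Theorem isoperimetric_euler_lagrange L g ys ya yb l :
  lagrangian X L -> lagrangian X g -> regular X L -> regular X g ->
  local_minimum X a b ya yb l L g ys -> ~ extremal X a g ys ->
  exists lambda : R,
    let F := fun t u v => L t u v - lambda * g t u v in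
    forall t, kappa X t ->
      is_delta_derive_on X (kappa X) (along X ys (partial_v F)) t
        (along X ys (partial_u F) t).
Proof.
  intros HL Hg HLR HgR Hmin Hext.
  pose proof (proj1 (proj1 Hmin)) as Cy.
  destruct (partial_u_integrable L ys HL HLR Cy) as [PL HPL].
  destruct (partial_u_integrable g ys Hg HgR Cy) as [Pg HPg].
  destruct (multiplier_exists L g ys PL Pg ya yb l HL Hg HLR HgR Hmin HPL HPg Hext)
    as [lambda [c Hc]].
  exists lambda; intros F t Kt.
  assert (HF : forall s, kappa X s ->
    along X ys (partial_u F) s
      = along X ys (partial_u L) s - lambda * along X ys (partial_u g) s /\
    along X ys (partial_v F) s
      = along X ys (partial_v L) s - lambda * along X ys (partial_v g) s).
  { intros s Ks; unfold along.
    destruct (lagrangian_partials L HL s (ys (sigma X s))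
      (delta_derive X ys s) Ks) as [Lu Lv].
    destruct (lagrangian_partials g Hg s (ys (sigma X s))
      (delta_derive X ys s) Ks) as [gu gv].
    split; apply is_derive_unique; unfold F.
    - apply (is_derive_minus (K := R_AbsRing) (V := R_NormedModule) (fun x => L s x _)
        (fun x => lambda * g s x _)); [exact Lu|].
      apply (is_derive_scal (fun x => g s x _)); exact gu.
    - apply (is_derive_minus (K := R_AbsRing) (V := R_NormedModule) (fun x => L s _ x)
        (fun x => lambda * g s _ x)); [exact Lv|].
      apply (is_derive_scal (fun x => g s _ x)); exact gv. }
  exists (fun s => c + 1 * (PL s - lambda * Pg s)); split.
  - intros s Ks; rewrite (proj2 (HF s Ks)).
    specialize (Hc s Ks); unfold reduced in Hc; lra.
  - rewrite (proj1 (HF t Kt)).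
    replace (along X ys (partial_u L) t - lambda * along X ys (partial_u g) t)
      with (0 + 1 * (along X ys (partial_u L) t
                     - lambda * along X ys (partial_u g) t)) by ring.
    apply (delta_derive_plus (fun _ => c) (fun s => 1 * (PL s - lambda * Pg s))).
    + apply delta_derive_ext with (fun s => c + 0 * s);
        auto using kappa_X, delta_derive_linear.
      intros; ring.
    + apply delta_derive_scal, delta_derive_minus; auto.
      apply delta_derive_scal; auto.
Qed.

End TimeScale.

Theorem theorem63 (T : R -> Prop) (a b ya yb l : R)
    (L g : R -> R -> R -> R) (ystar : R -> R)
    (hT : time_scale T) (ha : T a) (hb : T b) (hab : a < b)
    (hL : lagrangian (ts_interval T a b) L)
    (hg : lagrangian (ts_interval T a b) g)
    (hLR : regular (ts_interval T a b) L)
    (hgR : regular (ts_interval T a b) g)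
    (hmin : local_minimum (ts_interval T a b) a b ya yb l L g ystar)
    (hext : ~ extremal (ts_interval T a b) a g ystar) :
  let X := ts_interval T a b in
  exists lambda : R,
    let F := fun t u v => L t u v - lambda * g t u v in
    forall t, kappa (kappa X) t ->
      exists d,
        is_delta_derive_on X (kappa X) (along X ystar (partial_v F)) t d /\
        d - along X ystar (partial_u F) t = 0.
Proof.
  intros X.
  assert (X_closed : closed X).
  { apply closed_and; [apply hT|].
    apply closed_and; [apply closed_ge|apply closed_le]. }
  assert (X_bounds : forall t, X t -> a <= t <= b) by (intros t [_ Ht]; exact Ht).
  assert (X_a : X a) by (split; [exact ha|lra]).
  assert (X_b : X b) by (split; [exact hb|lra]).
  destruct (isoperimetric_euler_lagrange X a b X_closed X_a X_b hab X_bounds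
    L g ystar ya yb l hL hg hLR hgR hmin hext) as [lambda H].
  exists lambda; intros F t Kt.
  exists (along X ystar (partial_u F) t); split; [|ring].
  apply H, Kt.
Qed.
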